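(* Let $\mathsf{D}_\omega$ be the Dirac operator with MIT bag boundary conditions on the cone $\mathcal{C}_\omega$ defined in the context. If $\omega\in(0,\pi/2)$, then $$\int_{\mathcal{C}_\omega}|(\mathsf{D}_\omega u)(x)|^2\,dx\ \ge\ \left(\frac{\pi}{4\omega}\right)^2\int_{\mathcal{C}_\omega}\frac{|u(x)|^2}{|x|^2}\,dx\qquad\text{for all }u\in\mathrm{dom}\,\mathsf{D}_\omega .$$
   Context: Cone of half-aperture $\omega$: $\mathcal{C}_\omega=\{(x_1,x_2,x_3)\in\mathbb{R}^3: x_3>\cot\omega\,(x_1^2+x_2^2)^{1/2}\}$. Outward unit normal on $\partial\mathcal{C}_\omega$ at the point $(r\sin\omega\cos\phi,r\sin\omega\sin\phi,r\cos\omega)$, $r>0$, $\phi\in[0,2\pi)$: $\nu_\omega(r,\phi)=(\cos\omega\cos\phi,\cos\omega\sin\phi,-\sin\omega)$. Matrices: $\sigma_1=\begin{pmatrix}0&1\\1&0\end{pmatrix}$, $\sigma_2=\begin{pmatrix}0&-i\\i&0\end{pmatrix}$, $\sigma_3=\begin{pmatrix}1&0\\0&-1\end{pmatrix}$, $\alpha_j=\begin{pmatrix}0&\sigma_j\\\sigma_j&0\end{pmatrix}$ ($j=1,2,3$), $\beta=\begin{pmatrix}I_2&0\\0&-I_2\end{pmatrix}$, and $\alpha\cdot b=\alpha_1b_1+\alpha_2b_2+\alpha_3b_3$. Dirac differential expression: $\mathcal{D}=-i\,\alpha\cdot\nabla=-i(\alpha_1\partial_1+\alpha_2\partial_2+\alpha_3\partial_3)$.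 Dirac operator: in $L^2(\mathcal{C}_\omega;\mathbb{C}^4)$, $\mathsf{D}_\omega u=\mathcal{D}u$ with $$\mathrm{dom}\,\mathsf{D}_\omega=\{u\in C_0^\infty(\overline{\mathcal{C}_\omega}\setminus\mathbf{0};\mathbb{C}^4): u|_{\partial\mathcal{C}_\omega}+i\beta(\alpha\cdot\nu_\omega)u|_{\partial\mathcal{C}_\omega}=0\},$$ where $C_0^\infty(\overline{\mathcal{C}_\omega}\setminus\mathbf{0};\mathbb{C}^4)=\{u|_{\mathcal{C}_\omega}:u\in C_0^\infty(\mathbb{R}^3\setminus\{\mathbf{0}\};\mathbb{C}^4)\}$. *)

(* Defs.v *)
From mathcomp Require Import all_boot all_order all_algebra.
From mathcomp Require Import all_classical all_reals all_analysis.
From mathcomp.real_closed Require Import complex.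

Set Implicit Arguments.
Unset Strict Implicit.
Unset Printing Implicit Defensive.

Import Order.TTheory GRing.Theory Num.Theory.
Import numFieldTopology.Exports numFieldNormedType.Exports.

Local Open Scope classical_set_scope.
Local Open Scope ring_scope.

Notation R3 R := (R * R * R)%type.

(* The dimension is written 2 + 2 so that 4 x 4 matrices can be given by
   2 x 2 blocks. *)
Notation C4 R := ('cV[R[i]]_(2 + 2)).

Section Euclidean.
Context {R : realType}.
Implicit Types (x b : R3 R) (v : C4 R) (f : R3 R -> R) (U : R3 R -> C4 R).

Definition basis3 (j : 'I_3) : R3 R :=
  ((j == 0%N :> nat)%:R, (j == 1%N :> nat)%:R, (j == 2%N :> nat)%:R).

Definition coord3 (j : 'I_3) x : R := nth 0 [:: x.1.1; x.1.2; x.2] j.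

(* The norm `|x| that the library puts on the product R * R * R is the sup
   norm; here we need the Euclidean one. *)
Definition enorm x : R := Num.sqrt (\sum_(j < 3) coord3 j x ^+ 2).

Definition cnorm v : R :=
  Num.sqrt (\sum_k (complex.Re (v k 0) ^+ 2 + complex.Im (v k 0) ^+ 2)).

Definition lebesgue3 := ((@lebesgue_measure R \x @lebesgue_measure R)
                         \x @lebesgue_measure R)%E.

Definition iter_partial (s : seq 'I_3) f : R3 R -> R :=
  foldr (fun j g => 'D_(basis3 j) g) f s.

(* C^oo: all iterated partial derivatives exist everywhere and are continuous. *)
Definition smooth f : Prop :=
  forall s : seq 'I_3,
    continuous (iter_partial s f) /\
    forall (j : 'I_3) x, derivable (iter_partial s f) x (basis3 j).

Definition smoothC4 U : Prop :=
  forall k, smooth (fun x => complex.Re (U x k 0)) /\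
            smooth (fun x => complex.Im (U x k 0)).

Definition tsupport U : set (R3 R) := closure [set x | U x != 0].

(* C_0^oo(R^3 \ {0}; C^4), its elements being extended by 0 at the origin. *)
Definition test_function U : Prop :=
  [/\ smoothC4 U, compact (tsupport U) & ~ tsupport U (0, 0, 0)].

Definition partialC4 (j : 'I_3) U x : C4 R :=
  \col_k ('D_(basis3 j) (fun y => complex.Re (U y k 0)) x +i*
          'D_(basis3 j) (fun y => complex.Im (U y k 0)) x)%C.

End Euclidean.

Section Dirac.
Context {R : realType}.
Implicit Types (omega r phi : R) (x b : R3 R) (u : R3 R -> C4 R).

Definition mx2 (a b c d : R[i]) : 'M[R[i]]_2 :=
  @block_mx _ 1 1 1 1 a%:M b%:M c%:M d%:M.

Definition sigma1 : 'M[R[i]]_2 := mx2 0 1 1 0.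
Definition sigma2 : 'M[R[i]]_2 := mx2 0 (- 'i%C) 'i%C 0.
Definition sigma3 : 'M[R[i]]_2 := mx2 1 0 0 (-1).

(* The index j : 'I_3 stands for j + 1 in the usual numbering. *)
Definition sigma_mx (j : 'I_3) : 'M[R[i]]_2 :=
  nth 0 [:: sigma1; sigma2; sigma3] j.

Definition alpha_mx (j : 'I_3) : 'M[R[i]]_(2 + 2) :=
  block_mx 0 (sigma_mx j) (sigma_mx j) 0.

Definition beta_mx : 'M[R[i]]_(2 + 2) := block_mx 1%:M 0 0 (- 1%:M).

Definition alpha_dot b : 'M[R[i]]_(2 + 2) :=
  \sum_(j < 3) (coord3 j b)%:C%C *: alpha_mx j.

Definition dirac_op u x : C4 R :=
  - 'i%C *: \sum_(j < 3) alpha_mx j *m partialC4 j u x.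

Definition cone omega : set (R3 R) :=
  [set x | x.2 > cos omega / sin omega * Num.sqrt (x.1.1 ^+ 2 + x.1.2 ^+ 2)].

Definition cone_boundary_point omega r phi : R3 R :=
  (r * sin omega * cos phi, r * sin omega * sin phi, r * cos omega).

Definition cone_normal omega phi : R3 R :=
  (cos omega * cos phi, cos omega * sin phi, - sin omega).

(* MIT bag condition at the boundary points other than the vertex, where the
   normal is not defined. *)
Definition bag_condition omega (U : R3 R -> C4 R) : Prop :=
  forall r phi, 0 < r -> 0 <= phi < 2 * pi ->
    let p := cone_boundary_point omega r phi in
    U p + 'i%C *: (beta_mx *m alpha_dot (cone_normal omega phi) *m U p) = 0.

(* Elements of the domain are functions on the open cone: only the values of u
   there matter, and its boundary values are those of the smooth extension U
   (they are determined by u, by continuity). *)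
Definition dom_dirac omega u : Prop :=
  exists U, [/\ test_function U, {in cone omega, u =1 U} &
                bag_condition omega U].

End Dirac.

(* Main.v *)
From HB Require Import structures.
Require Import Defs.
From mathcomp Require Import all_boot all_order all_algebra.
From mathcomp Require Import all_classical all_reals all_analysis.
From mathcomp.real_closed Require Import complex.
From mathcomp Require Import measurable_realfun ring lra.
Import Order.TTheory GRing.Theory Num.Theory.
Import numFieldTopology.Exports numFieldNormedType.Exports.
Local Open Scope classical_set_scope.
Local Open Scope ring_scope.
Set Implicit Arguments.
Unset Strict Implicit.
Unset Printing Implicit Defensive.

(** The proof completes a square whose divergence term is tangential on the
    boundary.

    For [j <> k] the matrices [alpha_j alpha_k] are antihermitian, so the cross
    terms of [|D U|^2] are null Lagrangians: [|D U|^2 = |grad U|^2 + div W] with a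
    field [W] bilinear in [U] and its first derivatives ([divergence_flux]). The
    outward flux of [W] through the boundary only involves derivatives along the
    boundary. Differentiating the boundary condition there shows that these
    derivatives drop out: the flux is [|U|^2] times half of the curvature
    [cot omega / |x|] of the cone.

    For a positive function [H] with logarithmic gradient [X],
    [[
      |grad U|^2 = |grad U - U X|^2 + div (|U|^2 X) - (div X + |X|^2) |U|^2.
    ]]
    Take [H = |x|^(- 1/2 - b) (|x| + x3)^b] with
    [b = cos omega / (2 (1 - cos omega))]. For this [b] the flux of [X] is
    [- cot omega / (2 |x|)], so that [V = W + |U|^2 X] is tangential
    ([bag_tangential]) and [div V] has integral zero
    ([integral_divergence_upcone]). Since [ln (|x| + x3)] is harmonic, the
    potential [- (div X + |X|^2)] is explicit, and in the cone it is at least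
    [(1 + 2 cos omega) / (4 sin^2 omega |x|^2)] ([slope_riccati]). Finally
    [(w / sin w)^2 (1 + 2 cos w)] decreases on ]0, pi / 2] to the value
    [(pi / 2)^2], which makes that constant at least [(pi / (4 omega))^2]
    ([aperture_le]). For [omega = pi / 2] the two constants agree.

    The divergence theorem is proved in the sheared coordinates in which the
    cone is a half-space: there it reduces to Fubini and to the fundamental
    theorem of calculus on lines. The eight real components of [U] are treated as
    two Weyl spinors with four real components each, on which [D] acts as
    [sigma . grad]; the boundary condition exchanges the two. *)

(** * Differentiability from continuous partial derivatives *)

Section DirectionalCalculus.
Context {R : realType} {V : normedModType R}.
Implicit Types (f : V -> R) (x v : V).

Lemma is_derive_line f x v (t : R) : derivable f (x + t *: v) v ->
  is_derive t 1 (fun s : R => f (x + s *: v)) ('D_v f (x + t *: v)).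
Proof.
have E : (fun h : R => h^-1 *: (((fun s : R => f (x + s *: v)) \o shift t)
            (h *: 1) - f (x + t *: v))) =
         (fun h : R => h^-1 *: ((f \o shift (x + t *: v)) (h *: v)
            - f (x + t *: v))).
  apply/funext => h /=; congr (_ *: (f _ - _)).
  by rewrite [h *: 1]mulr1 scalerDl addrCA.
by move=> df; split; [rewrite /derivable E|rewrite /derive E].
Qed.

Lemma MVT_line f x v (h : R) : (forall t : R, derivable f (x + t *: v) v) ->
  exists2 t : R, `|t| <= `|h| & f (x + h *: v) - f x = h * 'D_v f (x + t *: v).
Proof.
move=> df; pose g (s : R) := f (x + s *: v).
have dg (t : R) : is_derive t (1 : R) g ('D_v f (x + t *: v)) by exact: is_derive_line.
have cg (a b : R) : {within `[a, b], continuous g}.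
  by apply: derivable_within_continuous => t _; apply: ex_derive.
have g0 : g 0 = f x by rewrite /g scale0r addr0.
have [h0|h0] := leP 0 h.
  have [t] := MVT_segment h0 (fun t _ => dg t) (cg 0 h).
  rewrite in_itv/= => /andP[t0 th]; rewrite g0 subr0 => E.
  exists t; first by rewrite !ger0_norm// (le_trans t0).
  by rewrite mulrC -E.
have [t] := MVT_segment (ltW h0) (fun t _ => dg t) (cg h 0).
rewrite in_itv/= => /andP[th t0]; rewrite g0 sub0r => E.
exists t; first by rewrite !ler0_norm ?lerN2// ltW.
by rewrite -opprB E mulrN opprK mulrC.
Qed.

End DirectionalCalculus.

Section R3.
Context {R : realType}.
Implicit Types (f : R3 R -> R) (x : R3 R).

Definition e1 : R3 R := (1, 0, 0).
Definition e2 : R3 R := (0, 1, 0).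
Definition e3 : R3 R := (0, 0, 1).

Lemma norm3E x : `|x| = Num.max (Num.max `|x.1.1| `|x.1.2|) `|x.2|.
Proof. by []. Qed.

Lemma norm3_le x (c : R) :
  (`|x| <= c) = [&& `|x.1.1| <= c, `|x.1.2| <= c & `|x.2| <= c].
Proof. by rewrite norm3E !ge_max andbA. Qed.

Lemma add_axes x (h : R3 R) :
  x + h.1.1 *: e1 + h.1.2 *: e2 + h.2 *: e3 = h + x.
Proof.
case: x h => [[x1 x2] x3] [[h1 h2] h3].
by congr (_, _, _); rewrite /= /GRing.scale /=; ring.
Qed.

Definition lin3 (a b c : R) : R3 R -> R :=
  fun h => h.1.1 * a + h.1.2 * b + h.2 * c.

Lemma lin3_is_linear a b c : linear (lin3 a b c).
Proof. by move=> k u v; rewrite /lin3 /= !/(_ *: _) /=; ring. Qed.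

HB.instance Definition _ a b c :=
  GRing.isLinear.Build R (R3 R) R *:%R (lin3 a b c) (lin3_is_linear a b c).

Lemma continuous_fst11 : continuous (fun x : R3 R => x.1.1).
Proof.
by move=> x; apply: (@cvg_comp _ _ _ fst _ _ (nbhs x.1)); [exact: cvg_fst|exact: cvg_fst].
Qed.
Lemma continuous_fst12 : continuous (fun x : R3 R => x.1.2).
Proof.
by move=> x; apply: (@cvg_comp _ _ _ fst _ _ (nbhs x.1)); [exact: cvg_fst|exact: cvg_snd].
Qed.
Lemma continuous_snd3 : continuous (fun x : R3 R => x.2).
Proof. by move=> x; exact: cvg_snd. Qed.

Lemma lin3_continuous a b c : continuous (lin3 a b c).
Proof.
move=> x; apply: cvgD; [apply: cvgD|]; apply: cvgM; try exact: cvg_cst.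
- exact: continuous_fst11.
- exact: continuous_fst12.
- exact: continuous_snd3.
Qed.

(** The increment from [x] to [x + h] is split along the three axes, and the mean
    value theorem turns each piece into a partial derivative at a point that
    tends to [x]. *)
Lemma differentiable_partials f x :
  (forall y, derivable f y e1) -> (forall y, derivable f y e2) ->
  (forall y, derivable f y e3) ->
  continuous ('D_e1 f) -> continuous ('D_e2 f) -> continuous ('D_e3 f) ->
  is_diff x f (lin3 ('D_e1 f x) ('D_e2 f x) ('D_e3 f x)).
Proof.
move=> d1 d2 d3 c1 c2 c3.
set L := lin3 _ _ _.
have H : (f \o shift x : R3 R -> R^o) =
      (cst (f x) + L : R3 R -> R^o) +o_ (0 : R3 R) (id : R3 R -> R3 R).
  apply/eqaddoP => e e0.
  have e30 : 0 < e / 3 by rewrite divr_gt0.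
  have K (g : R3 R -> R) : continuous g ->
      exists2 d : R, 0 < d & forall h, `|h| < d -> `|g x - g (x + h)| <= e / 3.
    move=> /(_ x)/cvgrPdist_le/(_ _ e30)/nbhs_ballP[d /= d0 D]; exists d => // h.
    move=> hd; apply: D; rewrite -ball_normE /=.
    by rewrite opprD addrA subrr sub0r normrN.
  have [r1 r10 R1] := K _ c1; have [r2 r20 R2] := K _ c2.
  have [r3 r30 R3'] := K _ c3.
  apply/nbhs_ballP; exists (Num.min r1 (Num.min r2 r3)) => /=.
    by rewrite !lt_min r10 r20 r30.
  move=> h; rewrite -ball_normE /= sub0r normrN !lt_min => /and3P[h1 h2 h3].
  have hle : `|h| <= `|h| by [].
  move: (hle); rewrite norm3_le => /and3P[a1 a2 a3].
  have [t1 t1h E1] := MVT_line h.1.1 (fun t => d1 (x + t *: e1)).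
  have [t2 t2h E2] := MVT_line h.1.2 (fun t => d2 (x + h.1.1 *: e1 + t *: e2)).
  have [t3 t3h E3] :=
    MVT_line h.2 (fun t => d3 (x + h.1.1 *: e1 + h.1.2 *: e2 + t *: e3)).
  have -> : (f \o shift x - (cst (f x) + L)) h =
      h.1.1 * ('D_e1 f (x + t1 *: e1) - 'D_e1 f x)
    + h.1.2 * ('D_e2 f (x + h.1.1 *: e1 + t2 *: e2) - 'D_e2 f x)
    + h.2 * ('D_e3 f (x + h.1.1 *: e1 + h.1.2 *: e2 + t3 *: e3) - 'D_e3 f x).
    transitivity (f (h + x) - (f x + (h.1.1 * 'D_e1 f x + h.1.2 * 'D_e2 f x
        + h.2 * 'D_e3 f x))); first by [].
    rewrite !mulrBr -E1 -E2 -E3 add_axes.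
    move: (f (h + x)) (f (_ + _ *: e2)) (f (x + _)) (f x) (h.1.1 * _) (h.1.2 * _).
    by move: (h.2 * _) => c F3 F2 F1 F0 a b; ring.
  have B (k : R3 R) (c : R) (g : R3 R -> R) (d : R) :
      (forall h, `|h| < d -> `|g x - g (x + h)| <= e / 3) ->
      `|c| <= `|h| -> `|k| <= `|h| -> `|h| < d ->
      `|c * (g (x + k) - g x)| <= `|h| * (e / 3).
    move=> gd ch kh hd; rewrite normrM distrC ler_pM//; apply: gd.
    exact: le_lt_trans hd.
  have nn : 0 <= `|h| by [].
  have -> : e * `|id h| = `|h| * (e / 3) + `|h| * (e / 3) + `|h| * (e / 3).
    by rewrite /=; field.
  apply: (le_trans (ler_normD _ _)); apply: lerD; first last.
    rewrite -!addrA. apply: (B _ _ ('D_e3 f) _ R3' _ _ h3) => //.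
    rewrite norm3_le /= /GRing.scale /= !mulr0 !mulr1 !addr0 !add0r a1 a2 /=.
    exact: le_trans a3.
  apply: (le_trans (ler_normD _ _)); apply: lerD; first last.
    rewrite -!addrA; apply: (B _ _ ('D_e2 f) _ R2 _ _ h2) => //.
    rewrite norm3_le /= /GRing.scale /= !mulr0 !mulr1 !addr0 !add0r a1 normr0 nn /=.
    by rewrite andbT; exact: le_trans a2.
  apply: (B _ _ ('D_e1 f) _ R1 _ _ h1) => //.
  rewrite norm3_le /= /GRing.scale /= !mulr0 !mulr1 normr0 nn /= andbT.
  exact: le_trans a1.
have cL : continuous L by exact: lin3_continuous.
have dE : 'd f x = L :> (R3 R -> R) := diff_unique cL H.
by split => //; apply/diff_locallyP; rewrite dE.
Qed.

End R3.

(** * Symmetry of second derivatives *)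

Section Schwarz.
Context {R : realType} {V : normedModType R}.
Implicit Types (f : V -> R) (x v w : V).

Lemma is_derive_translate f x v w : derivable f (x + w) v ->
  is_derive x v (fun y => f (y + w)) ('D_v f (x + w)).
Proof.
have E : (fun h : R => h^-1 *: (((fun y => f (y + w)) \o shift x) (h *: v)
             - f (x + w))) =
         (fun h : R => h^-1 *: ((f \o shift (x + w)) (h *: v) - f (x + w))).
  by apply/funext => h /=; rewrite addrA.
by move=> df; split; [rewrite /derivable E|rewrite /derive E].
Qed.

Lemma second_difference f x v w (s : R) :
  (forall y, derivable f y v) -> (forall y, derivable ('D_v f) y w) ->
  exists2 k : V, `|k| <= `|s| * (`|v| + `|w|) &
    f (x + s *: v + s *: w) - f (x + s *: v) - (f (x + s *: w) - f x)
    = s ^+ 2 * 'D_w ('D_v f) (x + k).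
Proof.
move=> dv dwv; pose g y := f (y + s *: w) - f y.
have dg y : is_derive y v g ('D_v f (y + s *: w) - 'D_v f y).
  exact: is_deriveB (is_derive_translate (dv _)) (derivableP (dv _)).
have [t ts E] := MVT_line s (fun t => @ex_derive _ _ _ _ _ _ _ (dg (x + t *: v))).
have [r rs F] := MVT_line s (fun r => dwv (x + t *: v + r *: w)).
exists (t *: v + r *: w).
  rewrite mulrDr (le_trans (ler_normD _ _))// !normrZ.
  by apply: lerD; rewrite ler_wpM2r.
by move: E; rewrite /g derive_val F addrA expr2 -mulrA.
Qed.

(** Both mixed derivatives are limits of the same second difference. *)
Lemma derive_comm f x v w :
  (forall y, derivable f y v) -> (forall y, derivable f y w) ->
  (forall y, derivable ('D_v f) y w) -> (forall y, derivable ('D_w f) y v) ->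
  continuous ('D_w ('D_v f)) -> continuous ('D_v ('D_w f)) ->
  'D_w ('D_v f) x = 'D_v ('D_w f) x.
Proof.
move=> dv dw dwv dvw cwv cvw; apply/eqP; rewrite -subr_eq0 -normr_le0.
apply/ler_addgt0Pr => e e0; rewrite add0r.
have e20 : 0 < e / 2 by rewrite divr_gt0.
have K (g : V -> R) : continuous g ->
    exists2 d : R, 0 < d & forall h, `|h| < d -> `|g x - g (x + h)| <= e / 2.
  move=> /(_ x)/cvgrPdist_le/(_ _ e20)/nbhs_ballP[d /= d0 D]; exists d => // h.
  move=> hd; apply: D; rewrite -ball_normE /=.
  by rewrite opprD addrA subrr sub0r normrN.
have [r1 r10 R1] := K _ cwv; have [r2 r20 R2] := K _ cvw.
pose c := `|v| + `|w| + 1.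
have c0 : 0 < c by rewrite /c ltr_wpDl ?addr_ge0.
pose s := Num.min r1 r2 / 2 / c.
have s0 : 0 < s by rewrite /s !divr_gt0// lt_min r10.
have sc : `|s| * (`|v| + `|w|) < Num.min r1 r2.
  rewrite gtr0_norm//; apply: (@le_lt_trans _ _ (s * c)).
    by rewrite ler_pM2l// /c lerDl.
  rewrite /s divfK ?gt_eqF// ltr_pdivrMr// ltr_pMr ?lt_min ?r10//.
  by rewrite ltr1n.
have [k kc E] := second_difference x s dv dwv.
have [l lc F] := second_difference x s dw dvw.
have := R1 k; have := R2 l.
have -> : `|k| < r1.
  by rewrite (le_lt_trans kc)// (lt_le_trans sc)// ge_min lexx.
have -> : `|l| < r2.
  rewrite (le_lt_trans lc)// addrC (lt_le_trans sc)//.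
  by rewrite ge_min lexx orbT.
move=> /(_ isT) L2 /(_ isT) L1; move: E F L1 L2.
have s20 : s ^+ 2 != 0 by rewrite gt_eqF// exprn_gt0.
rewrite (addrAC x (s *: w)).
move: ('D_w ('D_v f) x) ('D_v ('D_w f) x) => A B.
move: ('D_w ('D_v f) _) ('D_v ('D_w f) _) => A' B' E F L1 L2.
have G : A' = B' by apply: (mulfI s20); rewrite -E -F; ring.
rewrite -(subrKA A') {2}G (le_trans (ler_normD _ _))// (splitr e) lerD//.
by rewrite distrC.
Qed.

End Schwarz.

(** * Functions of class C^1 at a point *)

Section C1.
Context {R : realType}.
Implicit Types (f g : R3 R -> R) (x v : R3 R).

(** Regularity is asked at one point at a time because the fields used below are
    singular on the lower half of the axis of the cone. *)
Definition C1 f x := (\forall y \near x, differentiable f y) /\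
  forall v, {for x, continuous ('D_v f)}.

Lemma C1_differentiable f x : C1 f x -> differentiable f x.
Proof. by case=> /nbhs_singleton. Qed.

Lemma C1_derivable f x v : C1 f x -> derivable f x v.
Proof. by move=> /C1_differentiable; exact: diff_derivable. Qed.

Lemma C1_continuous f x : C1 f x -> {for x, continuous f}.
Proof. by move=> /C1_differentiable/differentiable_continuous. Qed.

Lemma near_eq_continuous f g x : {near x, f =1 g} ->
  {for x, continuous g} -> {for x, continuous f}.
Proof.
move=> fg cg; have fx : f x = g x by apply: (nbhs_singleton fg).
rewrite /prop_for /continuous_at fx; apply: cvg_trans cg.
by apply: near_eq_cvg; near=> y; rewrite (near fg y).
Unshelve. all: by end_near. Qed.

Lemma C1_cst (c : R) x : C1 (fun=> c) x.
Proof.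
split; first by near=> y; exact: differentiable_cst.
move=> v; have -> : 'D_v (fun=> c : R) = fun=> 0.
  by apply/funext => y; rewrite derive_cst.
exact: cvg_cst.
Unshelve. all: by end_near. Qed.

Lemma lin3_is_diff (a b c : R) x : is_diff x (lin3 a b c) (lin3 a b c).
Proof.
have cL := @lin3_continuous R a b c.
split; first exact: linear_differentiable.
exact: diff_lin.
Qed.

Lemma C1_lin3 (a b c : R) x : C1 (lin3 a b c) x.
Proof.
have D y : differentiable (lin3 a b c) y by case: (lin3_is_diff a b c y).
split; first by near=> y; exact: D.
move=> v; have -> : 'D_v (lin3 a b c) = fun=> lin3 a b c v.
  apply/funext => y; rewrite deriveE//.
  by rewrite (@diff_val _ _ _ _ _ _ _ (lin3_is_diff a b c y)).
exact: cvg_cst.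
Unshelve. all: by end_near. Qed.

Lemma C1D f g x : C1 f x -> C1 g x -> C1 (fun y => f y + g y) x.
Proof.
move=> [df cf] [dg cg]; split.
  by near=> y; apply: differentiableD; near: y.
move=> v; apply: (@near_eq_continuous _ (fun y => 'D_v f y + 'D_v g y)).
  near=> y; rewrite deriveD//; [near: y..].
  - by apply: filterS df => y; exact: diff_derivable.
  - by apply: filterS dg => y; exact: diff_derivable.
exact: (cvgD (cf v) (cg v)).
Unshelve. all: by end_near. Qed.

Lemma C1M f g x : C1 f x -> C1 g x -> C1 (fun y => f y * g y) x.
Proof.
move=> [df cf] [dg cg]; split.
  by near=> y; apply: differentiableM; near: y.
move=> v; apply: (@near_eq_continuous _ (fun y => f y * 'D_v g y + g y * 'D_v f y)).
  near=> y; rewrite deriveM//; [near: y..].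
  - by apply: filterS df => y; exact: diff_derivable.
  - by apply: filterS dg => y; exact: diff_derivable.
have cfx := C1_continuous (conj df cf); have cgx := C1_continuous (conj dg cg).
exact: (cvgD (cvgM cfx (cg v)) (cvgM cgx (cf v))).
Unshelve. all: by end_near. Qed.

Lemma C1N f x : C1 f x -> C1 (fun y => - f y) x.
Proof.
move=> Cf; have -> : (fun y => - f y) = (fun y => (- 1) * f y).
  by apply/funext => y; rewrite mulN1r.
exact: C1M (C1_cst _ _) Cf.
Qed.

Lemma C1B f g x : C1 f x -> C1 g x -> C1 (fun y => f y - g y) x.
Proof. by move=> Cf Cg; apply: C1D => //; exact: C1N. Qed.

Lemma C1V f x : f x != 0 -> C1 f x -> C1 (fun y => (f y)^-1) x.
Proof.
move=> fx0 [df cf]; have cfx : {for x, continuous f} by exact: C1_continuous.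
have f0 : \forall y \near x, f y != 0.
  exact: (cvgr_neq0 _ cfx fx0).
split.
  by near=> y; apply: differentiableV; near: y.
move=> v; apply: (@near_eq_continuous _ (fun y => - (f y) ^- 2 * 'D_v f y)).
  near=> y; rewrite deriveV//; [near: y..].
  - exact: f0.
  - by apply: filterS df => y; exact: diff_derivable.
apply: cvgM; last exact: (cf v).
apply: cvgN; apply: cvgV; first by rewrite expf_neq0.
by rewrite expr2; apply: cvgM.
Unshelve. all: by end_near. Qed.

Lemma derive_comp1 (g : R -> R) f x v :
  derivable g (f x) 1 -> differentiable f x ->
  'D_v (g \o f) x = 'D_1 g (f x) * 'D_v f x.
Proof.
move=> /derivable1_diffP dg df.
rewrite deriveE; last exact: differentiable_comp.
rewrite diff_comp//= deriv1E; last exact/derivable1_diffP.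
by rewrite derive1E -deriveE// mulrC.
Qed.

Lemma C1_sqrt f x : 0 < f x -> C1 f x -> C1 (fun y => Num.sqrt (f y)) x.
Proof.
move=> fx0 [df cf]; have cfx : {for x, continuous f} by exact: C1_continuous.
have f0 : \forall y \near x, 0 < f y.
  exact: (@cvgr_gt _ _ _ _ f _ cfx 0 fx0).
have dS (y : R3 R) : 0 < f y -> derivable (@Num.sqrt R) (f y) 1.
  by move=> /is_derive1_sqrt[].
split.
  near=> y; apply: (@differentiable_comp _ _ _ _ f Num.sqrt); first by near: y.
  by apply/derivable1_diffP/dS; near: y.
move=> v; apply: (@near_eq_continuous _
    (fun y => (2 * Num.sqrt (f y))^-1 * 'D_v f y)).
  near=> y; have fy0 : 0 < f y by near: y.
  rewrite (@derive_comp1 Num.sqrt f)//; last by near: y.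
    by rewrite derive_sqrt.
  exact: dS.
apply: cvgM; last exact: (cf v).
apply: cvgV; first by rewrite mulf_neq0// gt_eqF// sqrtr_gt0.
apply: cvgM; first exact: cvg_cst.
by apply: continuous_comp => //; exact: sqrt_continuous.
Unshelve. all: by end_near. Qed.

End C1.

Section Smooth.
Context {R : realType}.
Implicit Types (f : R3 R -> R) (x v : R3 R).

Lemma basis3_e1 : basis3 (inord 0) = e1 :> R3 R.
Proof. by rewrite /basis3 inordK. Qed.
Lemma basis3_e2 : basis3 (inord 1) = e2 :> R3 R.
Proof. by rewrite /basis3 inordK. Qed.
Lemma basis3_e3 : basis3 (inord 2) = e3 :> R3 R.
Proof. by rewrite /basis3 inordK. Qed.

Lemma smooth_derive f j : smooth f -> smooth ('D_(basis3 j) f).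
Proof.
move=> sf s; have := sf (rcons s j).
by rewrite /iter_partial foldr_rcons.
Qed.

Lemma smooth_derivable f x j : smooth f -> derivable f x (basis3 j).
Proof. by move=> /(_ [::])[_]; apply. Qed.

Lemma smooth_continuous f j : smooth f -> continuous ('D_(basis3 j) f).
Proof. by move=> /(_ [:: j])[]. Qed.

Lemma smooth_C1 f x : smooth f -> C1 f x.
Proof.
move=> sf.
have cf1 := @smooth_continuous f (inord 0) sf.
have cf2 := @smooth_continuous f (inord 1) sf.
have cf3 := @smooth_continuous f (inord 2) sf.
have df1 y := @smooth_derivable f y (inord 0) sf.
have df2 y := @smooth_derivable f y (inord 1) sf.
have df3 y := @smooth_derivable f y (inord 2) sf.
rewrite basis3_e1 in cf1 df1; rewrite basis3_e2 in cf2 df2.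
rewrite basis3_e3 in cf3 df3.
have D y := differentiable_partials y df1 df2 df3 cf1 cf2 cf3.
have df y : differentiable f y by case: (D y).
split; first by near=> y; exact: df.
move=> v; have -> : 'D_v f =
    fun y => v.1.1 * 'D_e1 f y + v.1.2 * 'D_e2 f y + v.2 * 'D_e3 f y.
  by apply/funext => y; rewrite deriveE// (@diff_val _ _ _ _ _ _ _ (D y)).
have cc (a : R) : (fun=> a) y @[y --> x] --> a by exact: cvg_cst.
exact: (cvgD (cvgD (cvgM (cc _) (cf1 x)) (cvgM (cc _) (cf2 x)))
  (cvgM (cc _) (cf3 x))).
Unshelve. all: by end_near. Qed.

Lemma smooth_derive_comm f x i j : smooth f ->
  'D_(basis3 i) ('D_(basis3 j) f) x = 'D_(basis3 j) ('D_(basis3 i) f) x.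
Proof.
move=> sf; apply: derive_comm; try by move=> y; apply: smooth_derivable => //;
  exact: smooth_derive.
all: by apply: smooth_continuous; exact: smooth_derive.
Qed.

(** Total differentiability is what lets several coordinates of the curve move at
    once, as they do along the boundary of the cone. *)
Lemma is_derive_curve f (c : R -> R3 R) (t : R) (a1 a2 a3 : R) :
  differentiable f (c t) ->
  is_derive t 1 (fun s => (c s).1.1) a1 ->
  is_derive t 1 (fun s => (c s).1.2) a2 ->
  is_derive t 1 (fun s => (c s).2) a3 ->
  is_derive t 1 (f \o c) ('D_(a1, a2, a3) f (c t)).
Proof.
move=> df [d1 E1] [d2 E2] [d3 E3].
have dc1 := (derivable1_diffP _ _).1 d1.
have dc2 := (derivable1_diffP _ _).1 d2.
have dc3 := (derivable1_diffP _ _).1 d3.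
have cE : c = fun s => (((c s).1.1, (c s).1.2), (c s).2).
  by apply/funext => s; case: (c s) => [[? ?] ?].
have dc : differentiable c t.
  by rewrite cE; apply: differentiable_pair => //; exact: differentiable_pair.
have D : 'd c t 1 = (a1, a2, a3).
  rewrite {1}cE diff_pair//=; last exact: differentiable_pair.
  by rewrite diff_pair//= -!deriveE// E1 E2 E3.
split; first by apply/derivable1_diffP; exact: differentiable_comp.
rewrite deriveE; last exact: differentiable_comp.
by rewrite diff_comp//= D -deriveE.
Qed.

Lemma derive_partials f x v : differentiable f x ->
  'D_v f x = v.1.1 * 'D_e1 f x + v.1.2 * 'D_e2 f x + v.2 * 'D_e3 f x.
Proof.
move=> df; rewrite !deriveE// -[v in LHS]addr0 -add_axes.
by rewrite add0r !linearD !linearZ.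
Qed.

End Smooth.

(** * Measurability and integration on the triple product *)

Section Measurability.
Context {R : realType}.
Local Notation mR := (measurableTypeR R).
Local Notation mR3 := (mR * mR * mR)%type.
Implicit Types (A D : set mR3).

(** The sigma-algebra on the triple product is generated by boxes, so open sets
    are reached as countable unions of boxes with rational corners. *)
Lemma open_measurable3 A : open (A : set (R3 R)) -> measurable A.
Proof.
move=> oA; pose I (p : rat * rat) : set mR := `]ratr p.1, ratr p.2[%classic.
pose B (q : (rat * rat) * (rat * rat) * (rat * rat)) : set mR3 :=
  (I q.1.1 `*` I q.1.2) `*` I q.2.
pose F q : set mR3 := if pselect (B q `<=` A) then B q else set0.
have -> : A = \bigcup_q F q.
  apply/seteqP; split => [x Ax|x [q _]]; last first.
    by rewrite /F; case: pselect => // BA /BA.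
  have /nbhs_ballP[d /= d0 dA] : nbhs (x : R3 R) A by exact: open_nbhs_nbhs.
  have Iex (t : R) : exists p : rat * rat, I p t /\ I p `<=` ball t d.
    have tl : t - d < t by rewrite ltrBlDr ltrDl.
    have tr : t < t + d by rewrite ltrDl.
    have [p /[!in_itv]/= /andP[p1 p2]] := rat_in_itvoo tl.
    have [q /[!in_itv]/= /andP[q1 q2]] := rat_in_itvoo tr.
    exists (p, q); split; rewrite /I /= ?in_itv/= ?p2//.
    move=> s; rewrite /= in_itv/= => /andP[ps sq]; rewrite /ball /=.
    by rewrite ltr_norml; apply/andP; split; lra.
  have [p1 [p1x p1d]] := Iex x.1.1; have [p2 [p2x p2d]] := Iex x.1.2.
  have [p3 [p3x p3d]] := Iex x.2.
  exists (p1, p2, p3) => //; rewrite /F; case: pselect => // -[].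
  move=> y [[/p1d y1 /p2d y2] /p3d y3]; apply: dA.
  by split => //; split.
apply: countable_bigcupT_measurable => // q; rewrite /F.
have mI p : measurable (I p) by exact: measurable_itv.
case: (pselect _) => BA; last exact: measurable0.
exact: (measurableX (measurableX (mI _) (mI _)) (mI _)).
Qed.

Lemma measurable_fun_continuous3 (D : set mR3) (f : R3 R -> R) :
  open (D : set (R3 R)) -> {in D, forall x, {for x, continuous f}} ->
  measurable_fun D (f : mR3 -> mR).
Proof.
move=> oD cf; apply: (measurability _ (RGenOpens.measurableE R)).
move=> _ [_ [a [b ->] <-]]; apply: open_measurable3.
rewrite openE => x [Dx abx].
apply: filterI; first by exact: open_nbhs_nbhs.
apply: (cf x (mem_set Dx)); apply: open_nbhs_nbhs; split => //.
Qed.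

End Measurability.

Section BoxIntegral.
Context {R : realType}.
Local Notation mR := (measurableTypeR R).
Local Notation mu := (@lebesgue_measure R).
Local Open Scope ereal_scope.

Lemma integrable_support d (T : measurableType d) (nu : {measure set T -> \bar R})
    (K : set T) (B : R) (g : T -> R) :
  measurable K -> nu K < +oo -> measurable_fun setT g ->
  (forall x, `|g x| <= B)%R -> (forall x, ~ K x -> g x = 0%R) ->
  nu.-integrable setT (EFin \o g).
Proof.
move=> mK nuK mg gB g0.
have -> : EFin \o g = (EFin \o g) \_ K.
  apply/funext => x; rewrite patchE; case: ifPn => // /negP xK /=.
  by rewrite g0// => Kx; apply: xK; rewrite inE.
apply/(integrable_mkcond _ mK)/measurable_bounded_integrable => //.
- exact: measurable_funS mg.
- exists B; split; first exact: num_real.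
  by move=> b Bb x Kx /=; rewrite (le_trans (gB x))// ltW.
Qed.

(** Named so that it can carry the instance of sigma-finite measure that the
    Fubini theorem asks for. *)
Definition lebesgue2 : set (mR * mR) -> \bar R := (mu \x mu).
HB.instance Definition _ := Measure.on lebesgue2.
Lemma lebesgue2X (A B : set mR) : measurable A -> measurable B ->
  lebesgue2 (A `*` B) = mu A * mu B.
Proof. by move=> mA mB; rewrite /lebesgue2 product_measure1E. Qed.

Lemma lebesgue2_sigma_finite : sigma_finite setT lebesgue2.
Proof.
have /sigma_finiteP[F [TF ndF Foo]] := sigma_finiteT mu.
exists (fun n => F n `*` F n).
  rewrite -setXTT {1}TF TF predeqE => -[x y]; split.
    move=> [/= [n _ Fnx] [k _ Gky]]; exists (maxn n k) => //; split.
    - by move: x Fnx; exact/subsetPset/ndF/leq_maxl.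
    - by move: y Gky; exact/subsetPset/ndF/leq_maxr.
  by move=> [n _ []/= ? ?]; split; exists n.
move=> k; have [? ?] := Foo k.
split; first exact: measurableX.
by rewrite /lebesgue2 product_measure1E// lte_mul_pinfty// ge0_fin_numE.
Qed.
HB.instance Definition _ := Measure_isSigmaFinite.Build _ _ _ lebesgue2 lebesgue2_sigma_finite.

Lemma fubini3_12 (g : mR * mR * mR -> \bar R) :
  lebesgue3.-integrable setT g ->
  \int[lebesgue3]_x g x = \int[lebesgue2]_x \int[mu]_z g (x, z).
Proof. by move=> H; have := @integral12_prod_meas1 _ _ _ _ R lebesgue2 mu g H. Qed.

Lemma fubini3_21 (g : mR * mR * mR -> \bar R) :
  lebesgue3.-integrable setT g ->
  \int[lebesgue3]_x g x = \int[mu]_z \int[lebesgue2]_x g (x, z).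
Proof. by move=> H; have := @integral21_prod_meas1 _ _ _ _ R lebesgue2 mu g H. Qed.

Lemma fubini2_12 (g : mR * mR -> \bar R) :
  lebesgue2.-integrable setT g ->
  \int[lebesgue2]_x g x = \int[mu]_x \int[mu]_y g (x, y).
Proof. by move=> H; have := @integral12_prod_meas1 _ _ _ _ R mu mu g H. Qed.

Lemma fubini2_21 (g : mR * mR -> \bar R) :
  lebesgue2.-integrable setT g ->
  \int[lebesgue2]_x g x = \int[mu]_y \int[mu]_x g (x, y).
Proof. by move=> H; have := @integral21_prod_meas1 _ _ _ _ R mu mu g H. Qed.

Definition seg (M : R) : set mR := `[(- M)%R, M]%classic.
Definition box2 M : set (mR * mR) := seg M `*` seg M.
Definition box3 M : set (mR * mR * mR) := box2 M `*` seg M.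

Lemma measurable_seg M : measurable (seg M).
Proof. exact: measurable_itv. Qed.
Lemma measurable_box2 M : measurable (box2 M).
Proof. exact: (measurableX (measurable_seg M) (measurable_seg M)). Qed.
Lemma measurable_box3 M : measurable (box3 M).
Proof. exact: (measurableX (measurable_box2 M) (measurable_seg M)). Qed.

Lemma seg_ltoo M : mu (seg M) < +oo.
Proof. by rewrite /seg lebesgue_measure_itv/=; case: ifP => _; rewrite ltry. Qed.
Lemma box2_ltoo M : lebesgue2 (box2 M) < +oo.
Proof.
rewrite /lebesgue2 product_measure1E; try exact: measurable_seg.
by apply: lte_mul_pinfty; rewrite ?ge0_fin_numE ?seg_ltoo.
Qed.
Lemma box3_ltoo M : lebesgue3 (box3 M) < +oo.
Proof.
rewrite /lebesgue3 product_measure1E; [|exact: measurable_box2|exact: measurable_seg].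
by apply: lte_mul_pinfty; rewrite ?ge0_fin_numE ?seg_ltoo ?box2_ltoo.
Qed.

Lemma segP M (t : R) : seg M t <-> (`|t| <= M)%R.
Proof. by rewrite /seg/= in_itv/= ler_norml. Qed.

Section Fubini0.
Variables (M B : R) (g : mR * mR * mR -> R).
Hypotheses (mg : measurable_fun setT g) (gB : forall x, (`|g x| <= B)%R)
  (g0 : forall x, ~ box3 M x -> g x = 0%R).

Lemma integrable_box3 : lebesgue3.-integrable setT (EFin \o g).
Proof. exact: (integrable_support (measurable_box3 M) (box3_ltoo M) mg gB). Qed.

Lemma integral3_axis3 :
  (forall x y, y != 0%R -> \int[mu]_z (g (x, y, z))%:E = 0) ->
  lebesgue3.-integrable setT (EFin \o g) /\ \int[lebesgue3]_x (g x)%:E = 0.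
Proof.
move=> H; split; first exact: integrable_box3.
rewrite (fubini3_12 integrable_box3).
rewrite (@ae_eq_integral _ _ _ lebesgue2 setT (cst 0))//.
- by rewrite integral_cst// mul0e.
- exact: (@measurable_fubini_F _ _ _ _ R lebesgue2 mu _ integrable_box3).
exists (setT `*` [set 0%R]); split.
- by apply: measurableX => //.
- by rewrite /= lebesgue2X// lebesgue_measure_set1 mule0.
- move=> [x y] /= nE; split => //=; apply: contrapT => /eqP y0.
  by apply: nE => _; exact: H.
Qed.

Lemma integral3_axis1 :
  (forall y z, y != 0%R -> \int[mu]_x (g (x, y, z))%:E = 0) ->
  lebesgue3.-integrable setT (EFin \o g) /\ \int[lebesgue3]_x (g x)%:E = 0.
Proof.
move=> H; split; first exact: integrable_box3.
rewrite (fubini3_21 integrable_box3).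
apply: integral0_eq => z _; rewrite /fubini_G.
have I : lebesgue2.-integrable setT (EFin \o (fun p => g (p, z))).
  apply: (integrable_support (measurable_box2 M) (box2_ltoo M)).
  - exact: measurableT_comp mg (measurable_pair2 z).
  - by move=> x; exact: gB.
  - by move=> x nx; apply: g0 => -[].
rewrite (fubini2_21 I).
rewrite (@ae_eq_integral _ _ _ mu setT (cst 0))//.
- by rewrite integral_cst// mul0e.
- exact: (@measurable_fubini_G _ _ _ _ R mu mu _ I).
exists [set 0%R]; split => //; first exact: lebesgue_measure_set1.
move=> y /= nE; apply: contrapT => /eqP y0.
by apply: nE => _; exact: H.
Qed.

Lemma integral3_axis2 :
  (forall x z, x != 0%R -> \int[mu]_y (g (x, y, z))%:E = 0) ->
  lebesgue3.-integrable setT (EFin \o g) /\ \int[lebesgue3]_x (g x)%:E = 0.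
Proof.
move=> H; split; first exact: integrable_box3.
rewrite (fubini3_21 integrable_box3).
apply: integral0_eq => z _; rewrite /fubini_G.
have I : lebesgue2.-integrable setT (EFin \o (fun p => g (p, z))).
  apply: (integrable_support (measurable_box2 M) (box2_ltoo M)).
  - exact: measurableT_comp mg (measurable_pair2 z).
  - by move=> x; exact: gB.
  - by move=> x nx; apply: g0 => -[].
rewrite (fubini2_12 I).
rewrite (@ae_eq_integral _ _ _ mu setT (cst 0))//.
- by rewrite integral_cst// mul0e.
- exact: (@measurable_fubini_F _ _ _ _ R mu mu _ I).
exists [set 0%R]; split => //; first exact: lebesgue_measure_set1.
move=> y /= nE; apply: contrapT => /eqP y0.
by apply: nE => _; exact: H.
Qed.

End Fubini0.

Lemma measurable_addl (a : R) : measurable_fun setT ((fun z => a + z)%R : mR -> mR).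
Proof. exact: measurable_funD. Qed.

Lemma lebesgue_measure_translation (a : R) (A : set mR) : measurable A ->
  pushforward mu ((fun z => a + z)%R : mR -> mR) A = mu A.
Proof.
move=> mA; apply/esym/lebesgue_measure_unique => //=.
  exact: measurable_addl.
move=> _ _ [[b c]] _ <-.
rewrite /pushforward.
have -> : ((fun z => a + z)%R @^-1` `]b, c]%classic) = `](b - a)%R, (c - a)%R]%classic.
  by apply/seteqP; split => z /=; rewrite !in_itv/= ltrBlDl lerBrDl.
rewrite !lebesgue_measure_itv/= !lte_fin ltrD2r.
by rewrite -!EFinB opprB addrA subrK.
Qed.

Lemma integral_translation (a : R) (f : mR -> \bar R) :
  measurable_fun setT f -> mu.-integrable setT (fun z => f (a + z)%R) ->
  \int[mu]_z f (a + z)%R = \int[mu]_z f z.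
Proof.
move=> mf If.
have := @integral_pushforward _ _ _ _ _ _ (measurable_addl a) mu setT f mf If
  measurableT.
rewrite preimage_setT => <-.
apply: eq_measure_integral => //=; first exact: measurable_addl.
by move=> _ A mA _; exact: lebesgue_measure_translation.
Qed.

(** The values of [g] at the ends are prescribed apart from those of [k]: the
    integrands below are cut off there by the indicator of a half-line. *)
Lemma integral_derive_eq0 (h k g : R -> R) (a b : R) : (a < b)%R ->
  (forall t : R, a <= t <= b -> is_derive t (1%R : R) h (k t))%R ->
  (forall t : R, a <= t <= b -> {for t, continuous k})%R ->
  (forall t : R, a < t < b -> g t = k t)%R ->
  (forall t : R, t <= a \/ b <= t -> g t = 0)%R -> h a = 0%R -> h b = 0%R ->
  \int[mu]_t (g t)%:E = 0.
Proof.
move=> ab hk ck gk g0 ha hb.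
have ch (t : R) : (a <= t <= b)%R -> {for t, continuous h}.
  by move=> /hk[dh _]; apply/differentiable_continuous/derivable1_diffP.
have -> : \int[mu]_t (g t)%:E = \int[mu]_(t in `]a, b[) (k t)%:E.
  rewrite [RHS]integral_mkcond; apply: eq_integral => t _.
  rewrite patchE; case: ifPn => /=.
    by rewrite inE/= in_itv/= => /gk ->.
  rewrite notin_setE/= in_itv/= => /negP/nandP tab; rewrite g0//.
  by move: tab; rewrite -!leNgt.
have ck' : {within `[a, b], continuous k}.
  apply: continuous_in_subspaceT => t; rewrite inE/= in_itv/=; exact: ck.
have mk : measurable_fun `]a, b[ (EFin \o k).
  apply: measurableT_comp => //; apply: open_continuous_measurable_fun.
    exact: interval_open.
  move=> t; rewrite inE/= in_itv/= => /andP[t1 t2].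
  by apply: ck; rewrite !ltW.
rewrite -(@integral_itv_bndoo _ _ _ _ true false mk).
rewrite (@continuous_FTC2 _ k h)//; first by rewrite ha hb subee.
- split.
  + move=> t; rewrite in_itv/= => /andP[t1 t2].
    have tab : (a <= t <= b)%R by rewrite !ltW.
    by case: (hk t tab).
  + by apply: cvg_at_right_filter; apply: ch; rewrite lexx ltW.
  + by apply: cvg_at_left_filter; apply: ch; rewrite lexx ltW.
- move=> t; rewrite in_itv/= => /andP[t1 t2].
  have tab : (a <= t <= b)%R by rewrite !ltW.
  by rewrite derive1E; case: (hk t tab).
Qed.

End BoxIntegral.

(** * The divergence theorem on a cone *)

Section Cone.
Context {R : realType} (m : R).
Hypothesis m0 : 0 < m.
Implicit Types (x v : R3 R) (f : R3 R -> R).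
Local Notation mR := (measurableTypeR R).
Local Notation mu := (@lebesgue_measure R).

Definition rho x : R := Num.sqrt (x.1.1 ^+ 2 + x.1.2 ^+ 2).

Definition upcone : set (R3 R) := [set x | m * rho x < x.2].

(** Maps the half-space [0 < x.2] onto the cone, with Jacobian 1. *)
Definition shear x : R3 R := (x.1.1, x.1.2, m * rho x + x.2).

Lemma rho_ge0 x : 0 <= rho x. Proof. exact: sqrtr_ge0. Qed.

Lemma le_rho1 x : `|x.1.1| <= rho x.
Proof. by rewrite -sqrtr_sqr ler_wsqrtr// lerDl sqr_ge0. Qed.

Lemma le_rho2 x : `|x.1.2| <= rho x.
Proof. by rewrite -sqrtr_sqr ler_wsqrtr// lerDr sqr_ge0. Qed.

Lemma rho_gt0 (a b z : R) : (a != 0) || (b != 0) -> 0 < rho (a, b, z).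
Proof.
move=> ab; rewrite /rho sqrtr_gt0/= lt_def addr_ge0 ?sqr_ge0// andbT.
by rewrite paddr_eq0 ?sqr_ge0// !sqrf_eq0 negb_and.
Qed.

Lemma cos1_le1 x : `|x.1.1 / rho x| <= 1.
Proof.
have := rho_ge0 x; rewrite le_eqVlt => /predU1P[<-|r0].
  by rewrite invr0 mulr0 normr0.
by rewrite normrM normfV (gtr0_norm r0) ler_pdivrMr// mul1r le_rho1.
Qed.

Lemma cos2_le1 x : `|x.1.2 / rho x| <= 1.
Proof.
have := rho_ge0 x; rewrite le_eqVlt => /predU1P[<-|r0].
  by rewrite invr0 mulr0 normr0.
by rewrite normrM normfV (gtr0_norm r0) ler_pdivrMr// mul1r le_rho2.
Qed.

Lemma continuous_rho : continuous rho.
Proof.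
move=> x; apply: continuous_comp; last exact: sqrt_continuous.
have c1 := @continuous_fst11 R x; have c2 := @continuous_fst12 R x.
exact: (cvgD (cvgM c1 c1) (cvgM c2 c2)).
Qed.

Lemma continuous_pair (T U W : topologicalType) (f : T -> U) (g : T -> W) (x : T) :
  {for x, continuous f} -> {for x, continuous g} ->
  {for x, continuous (fun y => (f y, g y))}.
Proof.
by move=> cf cg; apply: (@cvg_pair _ _ _ _ (nbhs (f x)) (nbhs (g x))).
Qed.

Lemma continuous_shear : continuous shear.
Proof.
move=> x; have c1 := @continuous_fst11 R x; have c2 := @continuous_fst12 R x.
have c3 := @continuous_snd3 R x.
have cm : (fun=> m) y @[y --> x] --> m by exact: cvg_cst.
have c4 : {for x, continuous (fun y : R3 R => m * rho y + y.2)}.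
  exact: (cvgD (cvgM cm (@continuous_rho x)) c3).
have c12 : {for x, continuous (fun y : R3 R => (y.1.1, y.1.2))}.
  exact: (@continuous_pair _ _ _ (fun y : R3 R => y.1.1) (fun y : R3 R => y.1.2)).
exact: (@continuous_pair _ _ _ (fun y : R3 R => (y.1.1, y.1.2)) _ _ c12 c4).
Qed.

Lemma open_halfspace : open [set x : R3 R | 0 < x.2].
Proof.
apply: (open_comp (f := fun x : R3 R => x.2) (D := [set y | 0 < y])).
  by move=> x _; exact: continuous_snd3.
exact: open_gt.
Qed.

Lemma open_upcone : open upcone.
Proof.
have -> : upcone = (fun x => x.2 - m * rho x) @^-1` [set y | 0 < y].
  by apply/funext => x /=; rewrite subr_gt0.
apply: open_comp; last exact: open_gt.
move=> x _; have cm : (fun=> m) y @[y --> x] --> m by exact: cvg_cst.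
exact: (cvgB (@continuous_snd3 R x) (cvgM cm (@continuous_rho x))).
Qed.

Lemma measurable_patch3 (D : set (R3 R)) f : open D ->
  (forall x, D x -> {for x, continuous f}) ->
  measurable_fun setT ((f \_ D) : mR * mR * mR -> mR).
Proof.
move=> oD cf.
apply/(measurable_restrictT _ (open_measurable3 oD)).
by apply: measurable_fun_continuous3 => // x /set_mem; exact: cf.
Qed.

Lemma measurable_cos1 :
  measurable_fun setT ((fun x => x.1.1 / rho x) : mR * mR * mR -> mR).
Proof.
have -> : (fun x => x.1.1 / rho x) =
    (fun x => x.1.1 / rho x) \_ [set x | 0 < rho x].
  apply/funext => x; rewrite patchE; case: ifPn => //.
  rewrite notin_setE/= lt_def rho_ge0 andbT => /negP; rewrite negbK => /eqP ->.
  by rewrite invr0 mulr0.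
apply: measurable_patch3 => [|x /= x0].
  apply: (open_comp (f := rho) (D := [set y | 0 < y])); last exact: open_gt.
  by move=> x _; exact: continuous_rho.
apply: cvgM; first exact: continuous_fst11.
apply: cvgV; [by rewrite gt_eqF|exact: continuous_rho].
Qed.

Lemma measurable_cos2 :
  measurable_fun setT ((fun x => x.1.2 / rho x) : mR * mR * mR -> mR).
Proof.
have -> : (fun x => x.1.2 / rho x) =
    (fun x => x.1.2 / rho x) \_ [set x | 0 < rho x].
  apply/funext => x; rewrite patchE; case: ifPn => //.
  rewrite notin_setE/= lt_def rho_ge0 andbT => /negP; rewrite negbK => /eqP ->.
  by rewrite invr0 mulr0.
apply: measurable_patch3 => [|x /= x0].
  apply: (open_comp (f := rho) (D := [set y | 0 < y])); last exact: open_gt.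
  by move=> x _; exact: continuous_rho.
apply: cvgM; first exact: continuous_fst12.
apply: cvgV; [by rewrite gt_eqF|exact: continuous_rho].
Qed.

Section ShellFunction.
Variables (M d : R).
Hypotheses (M0 : 0 < M) (d0 : 0 < d).

(** The half-space contains the closed cone except the vertex, and the shell keeps
    away from the vertex: on their intersection all derivatives are bounded. *)
Definition shellC1 f := forall x, 0 < x.2 ->
  C1 f x /\ (M < `|x| \/ `|x| < d -> f x = 0).

Lemma open_norm_gt : open [set x : R3 R | M < `|x|].
Proof.
apply: (open_comp (f := fun x : R3 R => `|x|) (D := [set y | M < y])).
  by move=> x _; exact: norm_continuous.
exact: open_gt.
Qed.

Lemma open_norm_lt : open [set x : R3 R | `|x| < d].
Proof.
apply: (open_comp (f := fun x : R3 R => `|x|) (D := [set y | y < d])).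
  by move=> x _; exact: norm_continuous.
exact: open_lt.
Qed.

Lemma shellC1_derive0 f v x : shellC1 f -> 0 < x.2 ->
  M < `|x| \/ `|x| < d -> 'D_v f x = 0.
Proof.
move=> sf x0 xMd.
rewrite (@near_eq_derive _ _ _ f (cst 0))//; first exact: derive_cst.
have n1 : \forall y \near x, M < `|y| \/ `|y| < d.
  case: xMd => h.
    have : \forall y \near x, M < `|y| by apply: (open_nbhs_nbhs (conj open_norm_gt h)).
    by apply: filterS => y; left.
  have : \forall y \near x, `|y| < d by apply: (open_nbhs_nbhs (conj open_norm_lt h)).
  by apply: filterS => y; right.
have n2 : \forall y \near x, 0 < y.2 by apply: (open_nbhs_nbhs (conj open_halfspace x0)).
near=> y; have y0 : 0 < y.2 by near: y.
by have [_ ->] := sf y y0 => //; near: y.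
Unshelve. all: by end_near. Qed.

(** In the cone a point of small height is close to the vertex, where [f]
    vanishes; what remains lies in a compact box of the half-space. *)
Lemma shellC1_bounded f v : shellC1 f -> exists2 B : R, 0 <= B &
  forall x, 0 < x.2 -> m * rho x <= x.2 -> `|'D_v f x| <= B.
Proof.
move=> sf.
pose e := Num.min d (m * d) / 2.
have e0 : 0 < e by rewrite /e divr_gt0// lt_min d0 mulr_gt0.
pose K : set (R3 R) := (`[(- M), M] `*` `[(- M), M]) `*` `[e, M].
have cK : compact K.
  by apply: compact_setX; [apply: compact_setX|]; exact: segment_compact.
have cD : {within K, continuous ('D_v f)}.
  apply: continuous_in_subspaceT => x; rewrite inE => -[_ /=].
  rewrite in_itv/= => /andP[ex _].
  by have [[_ /(_ v)]] := sf x (lt_le_trans e0 ex).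
have [b [_ bb]] := compact_bounded (continuous_compact cD cK).
have b1 : `|b| < `|b| + 1 by rewrite ltrDl.
exists (`|b| + 1); first by rewrite addr_ge0.
move=> x x0 xc; have [Mx|xM] := ltP M `|x|.
  by rewrite (shellC1_derive0 v sf x0 (or_introl Mx)) normr0 addr_ge0.
have [ex|xe] := leP e x.2.
  apply: (bb (`|b| + 1) (le_lt_trans (ler_norm b) b1)); exists x => //.
  move: xM; rewrite norm3_le => /and3P[x1 x2 x3].
  split => /=; last by rewrite in_itv/= ex (le_trans (ler_norm _)).
  by split; rewrite /= in_itv/= -ler_norml.
have xd : `|x| < d.
  have rd : rho x < d.
    rewrite -(ltr_pM2l m0) (le_lt_trans xc)// (lt_le_trans xe)//.
    rewrite /e ler_pdivrMr//; apply: (le_trans (y := m * d)).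
      by rewrite ge_min lexx orbT.
    by rewrite ler_peMr ?mulr_ge0 ?ltW// ltr1n.
  rewrite norm3E !gt_max (le_lt_trans (le_rho1 x) rd) (le_lt_trans (le_rho2 x) rd).
  rewrite gtr0_norm//= (lt_le_trans xe)// /e ler_pdivrMr//.
  apply: (le_trans (y := d)); first by rewrite ge_min lexx.
  by rewrite ler_peMr ?ltW// ltr1n.
by rewrite (shellC1_derive0 v sf x0 (or_intror xd)) normr0 addr_ge0.
Qed.

(** Extended by zero, so that integrals over the cone become integrals over the
    whole space, to which Fubini applies in any order. *)
Definition sheard f v : R3 R -> R :=
  (('D_v f) \o shear) \_ [set x | 0 < x.2].

Lemma sheardE f v x : 0 < x.2 -> sheard f v x = 'D_v f (shear x).
Proof. by move=> x0; rewrite /sheard patchE mem_set. Qed.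

Lemma sheard0 f v x : x.2 <= 0 -> sheard f v x = 0.
Proof.
move=> x0; rewrite /sheard patchE memNset//=.
by apply/negP; rewrite -leNgt.
Qed.

Lemma shear_gt0 x : 0 < x.2 -> 0 < (shear x).2.
Proof. by move=> x0; rewrite /= ltr_wpDl// mulr_ge0 ?rho_ge0// ltW. Qed.

Lemma measurable_sheard f v : shellC1 f ->
  measurable_fun setT (sheard f v : mR * mR * mR -> mR).
Proof.
move=> sf; apply: measurable_patch3; first exact: open_halfspace.
move=> x /shear_gt0 x0; apply: continuous_comp; first exact: continuous_shear.
by have [[_ /(_ v)]] := sf _ x0.
Qed.

Lemma sheard_bounded f v : shellC1 f -> exists2 B : R, 0 <= B &
  forall x, `|sheard f v x| <= B.
Proof.
move=> sf; have [B B0 HB] := shellC1_bounded v sf.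
exists B => // x; have [x0|x0] := ltP 0 x.2; last by rewrite sheard0// normr0.
rewrite sheardE//; apply: HB; first exact: shear_gt0.
by rewrite /= [rho (shear x)]/(rho x) lerDl ltW.
Qed.

Lemma shear_norm_gt x : 0 < x.2 -> ~ box3 M x -> M < `|shear x|.
Proof.
move=> x0 nb; rewrite ltNge norm3_le; apply/negP => /and3P[/= x1 x2].
rewrite gtr0_norm ?shear_gt0// => x3; apply: nb; split; first by split; exact/segP.
apply/segP; rewrite gtr0_norm//; apply: le_trans x3.
by rewrite lerDr mulr_ge0 ?rho_ge0// ltW.
Qed.

Lemma sheard_support f v : shellC1 f -> forall x, ~ box3 M x -> sheard f v x = 0.
Proof.
move=> sf x nb; have [x0|x0] := ltP 0 x.2; last exact: sheard0.
rewrite sheardE//; apply: shellC1_derive0 => //; first exact: shear_gt0.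
by left; exact: shear_norm_gt.
Qed.

Lemma is_derive_rho1 (t y z : R) : 0 < rho (t, y, z) ->
  is_derive t (1 : R) (fun s => rho (s, y, z)) (t / rho (t, y, z)).
Proof.
move=> r0; have p0 : 0 < t ^+ 2 + y ^+ 2 by move: r0; rewrite /rho sqrtr_gt0.
have D1 : is_derive t (1 : R) (fun s : R => s ^+ 2 + y ^+ 2) (2 * t).
  apply: is_derive_eq; rewrite addr0 /GRing.scale /= mulr1.
  by rewrite mulr_natl mulr2n.
have D2 := is_derive1_sqrt p0.
have E : (2 * Num.sqrt (t ^+ 2 + y ^+ 2))^-1 * (2 * t) = t / rho (t, y, z).
  rewrite invfM mulrC mulrA [2 * t * _]mulrAC mulfV ?pnatr_eq0// mul1r.
  by [].
rewrite -E.
exact: (@is_derive1_comp _ Num.sqrt (fun s : R => s ^+ 2 + y ^+ 2)).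
Qed.

Lemma rho_swap (s y z : R) : rho (y, s, z) = rho (s, y, z).
Proof. by rewrite /rho /= addrC. Qed.

Lemma is_derive_rho2 (t y z : R) : 0 < rho (y, t, z) ->
  is_derive t (1 : R) (fun s => rho (y, s, z)) (t / rho (y, t, z)).
Proof.
have -> : (fun s => rho (y, s, z)) = fun s => rho (s, y, z).
  by apply/funext => s; rewrite rho_swap.
by rewrite rho_swap; exact: is_derive_rho1.
Qed.

Lemma is_derive_height (r : R -> R) (t z r' : R) : is_derive t (1 : R) r r' ->
  is_derive t (1 : R) (fun s => m * r s + z) (m * r').
Proof.
move=> D; rewrite -[X in is_derive _ _ _ X]addr0.
exact: (is_deriveD (is_deriveZ m D) (is_derive_cst _ _ _)).
Qed.

Lemma opp_ltM1 : - (M + 1) < M + 1. Proof. by rewrite gtrN// addr_gt0. Qed.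

(** In the sheared coordinates [e1 + m * (x1 / rho) * e3] becomes the first axis,
    so this derivative integrates to zero on every line parallel to it. The
    lines through the vertical axis, where [rho] has a corner, are negligible. *)
Lemma integral_slanted1 f : shellC1 f ->
  let g x := sheard f e1 x + m * (x.1.1 / rho x) * sheard f e3 x in
  lebesgue3.-integrable setT (EFin \o g) /\
  (\int[lebesgue3]_x (g x)%:E = 0)%E.
Proof.
move=> sf g; have [B1 B10 HB1] := sheard_bounded e1 sf.
have [B3 B30 HB3] := sheard_bounded e3 sf.
apply: (@integral3_axis1 _ M (B1 + m * B3)).
- apply: measurable_funD; first exact: measurable_sheard.
  apply: measurable_funM; last exact: measurable_sheard.
  by apply: measurable_funM => //; exact: measurable_cos1.
- move=> x; apply: (le_trans (ler_normD _ _)); apply: lerD => //.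
  rewrite normrM ler_pM// normrM gtr0_norm// ler_piMr ?cos1_le1//.
  exact: ltW.
- by move=> x nx; rewrite /g !sheard_support// mulr0 addr0.
move=> y z y0; have [z0|z0] := leP z 0.
  by apply: integral0_eq => x _; rewrite /g !sheard0// mulr0 addr0.
pose p (t : R) : R3 R := shear (t, y, z).
pose k (t : R) := 'D_e1 f (p t) + m * (t / rho (t, y, z)) * 'D_e3 f (p t).
have p0 (t : R) : 0 < (p t).2 by exact: shear_gt0.
have pM (t : R) : t <= - (M + 1) \/ M + 1 <= t -> M < `|p t|.
  move=> tM; apply: shear_norm_gt => // -[[/segP /= + _] _].
  by rewrite ler_norml => /andP[]; case: tM; lra.
have r0 (t : R) : 0 < rho (t, y, z) by rewrite rho_gt0// y0 orbT.
have kE (t : R) : sheard f e1 (t, y, z) +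
    m * (t / rho (t, y, z)) * sheard f e3 (t, y, z) = k t by rewrite !sheardE.
apply: (@integral_derive_eq0 _ (f \o p) k _ _ _ opp_ltM1).
- move=> t _; have df := C1_differentiable (sf _ (p0 t)).1.
  have := is_derive_curve (c := p) df (is_derive_id _ _) (is_derive_cst _ _ _)
    (is_derive_height z (is_derive_rho1 (r0 t))).
  by rewrite derive_partials//= mul0r addr0 mul1r.
- move=> t _; have [[_ C1f] _] := sf _ (p0 t).
  have cp1 : {for t, continuous (fun s : R => (s, y, z) : R3 R)}.
    apply: continuous_pair; last exact: cvg_cst.
    by apply: continuous_pair; [exact: cvg_id|exact: cvg_cst].
  have cp : {for t, continuous p}.
    by apply: continuous_comp; [exact: cp1|exact: continuous_shear].
  have c1 : {for t, continuous ('D_e1 f \o p)} by apply: continuous_comp.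
  have c3 : {for t, continuous ('D_e3 f \o p)} by apply: continuous_comp.
  have cr : {for t, continuous (fun s => rho (s, y, z))}.
    by apply: (continuous_comp cp1); exact: continuous_rho.
  have ri : {for t, continuous (fun s => (rho (s, y, z))^-1)}.
    by apply: cvgV => //; rewrite gt_eqF// rho_gt0// y0 orbT.
  have cm : {for t, continuous (fun=> m : R)} by exact: cvg_cst.
  have ci : {for t, continuous (fun s : R => s)} by exact: cvg_id.
  exact: (cvgD c1 (cvgM (cvgM cm (cvgM ci ri)) c3)).
- by move=> t _; rewrite /g -kE.
- move=> t tM; have D0 v := shellC1_derive0 v sf (p0 t) (or_introl (pM t tM)).
  by rewrite /g kE /k !D0 mulr0 addr0.
- by apply: (sf _ (p0 _)).2; left; apply: pM; left.
- by apply: (sf _ (p0 _)).2; left; apply: pM; right.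
Qed.

Lemma integral_slanted2 f : shellC1 f ->
  let g x := sheard f e2 x + m * (x.1.2 / rho x) * sheard f e3 x in
  lebesgue3.-integrable setT (EFin \o g) /\
  (\int[lebesgue3]_x (g x)%:E = 0)%E.
Proof.
move=> sf g; have [B1 B10 HB1] := sheard_bounded e2 sf.
have [B3 B30 HB3] := sheard_bounded e3 sf.
apply: (@integral3_axis2 _ M (B1 + m * B3)).
- apply: measurable_funD; first exact: measurable_sheard.
  apply: measurable_funM; last exact: measurable_sheard.
  by apply: measurable_funM => //; exact: measurable_cos2.
- move=> x; apply: (le_trans (ler_normD _ _)); apply: lerD => //.
  rewrite normrM ler_pM// normrM gtr0_norm// ler_piMr ?cos2_le1//.
  exact: ltW.
- by move=> x nx; rewrite /g !sheard_support// mulr0 addr0.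
move=> y z y0; have [z0|z0] := leP z 0.
  by apply: integral0_eq => x _; rewrite /g !sheard0// mulr0 addr0.
pose p (t : R) : R3 R := shear (y, t, z).
pose k (t : R) := 'D_e2 f (p t) + m * (t / rho (y, t, z)) * 'D_e3 f (p t).
have p0 (t : R) : 0 < (p t).2 by exact: shear_gt0.
have pM (t : R) : t <= - (M + 1) \/ M + 1 <= t -> M < `|p t|.
  move=> tM; apply: shear_norm_gt => // -[[_ /segP /= +] _].
  by rewrite ler_norml => /andP[]; case: tM; lra.
have r0 (t : R) : 0 < rho (y, t, z) by rewrite rho_gt0// y0.
have kE (t : R) : sheard f e2 (y, t, z) +
    m * (t / rho (y, t, z)) * sheard f e3 (y, t, z) = k t by rewrite !sheardE.
apply: (@integral_derive_eq0 _ (f \o p) k _ _ _ opp_ltM1).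
- move=> t _; have df := C1_differentiable (sf _ (p0 t)).1.
  have := is_derive_curve (c := p) df (is_derive_cst _ _ _) (is_derive_id _ _)
    (is_derive_height z (is_derive_rho2 (r0 t))).
  by rewrite derive_partials//= mul0r add0r mul1r.
- move=> t _; have [[_ C1f] _] := sf _ (p0 t).
  have cp1 : {for t, continuous (fun s : R => (y, s, z) : R3 R)}.
    apply: continuous_pair; last exact: cvg_cst.
    by apply: continuous_pair; [exact: cvg_cst|exact: cvg_id].
  have cp : {for t, continuous p}.
    by apply: continuous_comp; [exact: cp1|exact: continuous_shear].
  have c1 : {for t, continuous ('D_e2 f \o p)} by apply: continuous_comp.
  have c3 : {for t, continuous ('D_e3 f \o p)} by apply: continuous_comp.
  have cr : {for t, continuous (fun s => rho (y, s, z))}.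
    by apply: (continuous_comp cp1); exact: continuous_rho.
  have ri : {for t, continuous (fun s => (rho (y, s, z))^-1)}.
    by apply: cvgV => //; rewrite gt_eqF// rho_gt0// y0.
  have cm : {for t, continuous (fun=> m : R)} by exact: cvg_cst.
  have ci : {for t, continuous (fun s : R => s)} by exact: cvg_id.
  exact: (cvgD c1 (cvgM (cvgM cm (cvgM ci ri)) c3)).
- by move=> t _; rewrite /g -kE.
- move=> t tM; have D0 v := shellC1_derive0 v sf (p0 t) (or_introl (pM t tM)).
  by rewrite /g kE /k !D0 mulr0 addr0.
- by apply: (sf _ (p0 _)).2; left; apply: pM; left.
- by apply: (sf _ (p0 _)).2; left; apply: pM; right.
Qed.

Lemma is_derive_vertical f (x y t : R) : 0 < (shear (x, y, t)).2 -> shellC1 f ->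
  is_derive t (1 : R) (fun s => f (shear (x, y, s))) ('D_e3 f (shear (x, y, t))).
Proof.
move=> p0 sf; have df := C1_differentiable (sf _ p0).1.
have D : is_derive t (1 : R) (fun s : R => m * rho (x, y, t) + s) 1.
  rewrite -[X in is_derive _ _ _ X]add0r.
  exact: (is_deriveD (is_derive_cst _ _ _) (is_derive_id _ _)).
exact: (is_derive_curve (c := fun s => shear (x, y, s)) df
  (is_derive_cst _ _ _) (is_derive_cst _ _ _) D).
Qed.

(** On a vertical line what survives is the value at the foot, on the boundary of
    the cone; there it is the flux through the boundary, up to a factor. *)
Lemma integral_vertical f1 f2 f3 : shellC1 f1 -> shellC1 f2 -> shellC1 f3 ->
  (forall x : R3 R, x.1.2 != 0 -> x.2 = 0 ->
    f3 (shear x) = m * (x.1.1 / rho x) * f1 (shear x)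
                 + m * (x.1.2 / rho x) * f2 (shear x)) ->
  let g x := sheard f3 e3 x - (m * (x.1.1 / rho x) * sheard f1 e3 x
      + m * (x.1.2 / rho x) * sheard f2 e3 x) in
  lebesgue3.-integrable setT (EFin \o g) /\
  (\int[lebesgue3]_x (g x)%:E = 0)%E.
Proof.
move=> s1 s2 s3 bc g.
have [B1 B10 HB1] := sheard_bounded e3 s1.
have [B2 B20 HB2] := sheard_bounded e3 s2.
have [B3 B30 HB3] := sheard_bounded e3 s3.
apply: (@integral3_axis3 _ M (B3 + (m * B1 + m * B2))).
- apply: measurable_funB; first exact: measurable_sheard.
  apply: measurable_funD; apply: measurable_funM; try exact: measurable_sheard.
    by apply: measurable_funM => //; exact: measurable_cos1.
  by apply: measurable_funM => //; exact: measurable_cos2.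
- move=> x; apply: (le_trans (ler_normB _ _)); apply: lerD => //.
  apply: (le_trans (ler_normD _ _)); apply: lerD.
    rewrite normrM ler_pM// normrM gtr0_norm// ler_piMr ?cos1_le1//.
    exact: ltW.
  rewrite normrM ler_pM// normrM gtr0_norm// ler_piMr ?cos2_le1//.
  exact: ltW.
- by move=> x nx; rewrite /g !sheard_support// !mulr0 addr0 subr0.
move=> x y y0; pose p (t : R) : R3 R := shear (x, y, t).
have r0 t : 0 < rho (x, y, t) by rewrite rho_gt0// y0 orbT.
pose c1 := m * (x / rho (x, y, 0)); pose c2 := m * (y / rho (x, y, 0)).
have p0 (t : R) : 0 <= t -> 0 < (p t).2.
  by move=> t0; rewrite /= ltr_pwDl// mulr_gt0.
pose k (t : R) := 'D_e3 f3 (p t) - (c1 * 'D_e3 f1 (p t) + c2 * 'D_e3 f2 (p t)).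
pose h (t : R) := f3 (p t) - (c1 * f1 (p t) + c2 * f2 (p t)).
have kE (t : R) : 0 < t -> sheard f3 e3 (x, y, t)
    - (m * (x / rho (x, y, t)) * sheard f1 e3 (x, y, t)
     + m * (y / rho (x, y, t)) * sheard f2 e3 (x, y, t)) = k t.
  by move=> t0; rewrite !sheardE.
have M10 : 0 < M + 1 by rewrite addr_gt0.
have pM (t : R) : M + 1 <= t -> M < `|p t|.
  move=> tM; apply: shear_norm_gt => [|[_ /segP /= tM']].
    exact: lt_le_trans tM.
  by have := le_trans tM (le_trans (ler_norm t) tM'); rewrite gerDl ler10.
apply: (@integral_derive_eq0 _ h k _ 0 (M + 1)) => //.
- move=> t /andP[t0 _].
  have D1 := is_derive_vertical (p0 t t0) s1.
  have D2 := is_derive_vertical (p0 t t0) s2.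
  have D3 := is_derive_vertical (p0 t t0) s3.
  exact: (is_deriveB D3 (is_deriveD (is_deriveZ c1 D1) (is_deriveZ c2 D2))).
- move=> t /andP[t0 _]; have cp : {for t, continuous p}.
    apply: continuous_comp; last exact: continuous_shear.
    by apply: continuous_pair; [exact: cvg_cst|exact: cvg_id].
  have ck f : shellC1 f -> {for t, continuous ('D_e3 f \o p)}.
    by move=> sf; apply: continuous_comp => //; have [[]] := sf _ (p0 t t0).
  have cc (a : R) : {for t, continuous (fun=> a : R)} by exact: cvg_cst.
  exact: (cvgB (ck _ s3) (cvgD (cvgM (cc c1) (ck _ s1)) (cvgM (cc c2) (ck _ s2)))).
- by move=> t /andP[t0 _]; rewrite /g -kE.
- move=> t [t0|tM]; first by rewrite /g !sheard0// !mulr0 addr0 subr0.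
  have t0 : 0 < t by lra.
  have D0 f (sf : shellC1 f) :=
    shellC1_derive0 e3 sf (p0 t (ltW t0)) (or_introl (pM t tM)).
  by rewrite /g kE// /k !D0// !mulr0 addr0 subr0.
- by rewrite /h (bc (x, y, 0))//= subrr.
- have H f (sf : shellC1 f) : f (p (M + 1)) = 0.
    by apply: (sf _ (p0 _ (ltW M10))).2; left; exact: pM.
  by rewrite /h !H// !mulr0 addr0 subr0.
Qed.

Lemma upcone_shear x : upcone (shear x) <-> 0 < x.2.
Proof. by rewrite /upcone /= [rho (shear x)]/(rho x) ltrDl. Qed.

Lemma box3_shear x : 0 < x.2 -> ~ box3 M x -> ~ box3 M (shear x).
Proof.
move=> x0 nb [[/= b1 b2] /segP b3]; apply: nb; split => //; apply/segP.
rewrite gtr0_norm//; apply: le_trans (le_trans (ler_norm _) b3).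
by rewrite lerDr mulr_ge0 ?rho_ge0// ltW.
Qed.

(** On each vertical line the shear is a translation. *)
Lemma integral_shear (g : R3 R -> R) (B : R) :
  (forall x, upcone x -> {for x, continuous g}) ->
  (forall x, upcone x -> `|g x| <= B) -> 0 <= B ->
  (forall x, upcone x -> ~ box3 M x -> g x = 0) ->
  lebesgue3.-integrable upcone (EFin \o g) /\
  (\int[lebesgue3]_(x in upcone) (g x)%:E =
   \int[lebesgue3]_x (((g \o shear) \_ [set x | 0%R < x.2]) x)%:E)%E.
Proof.
move=> cg gB B0 g0; pose G := g \_ upcone.
have GE : (EFin \o g) \_ upcone = EFin \o G.
  by apply/funext => x; rewrite /G /= !patchE; case: ifP.
have mG : measurable_fun setT (G : mR * mR * mR -> mR).
  by apply: measurable_patch3 => //; exact: open_upcone.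
have GB x : `|G x| <= B.
  by rewrite /G patchE; case: ifPn => [/set_mem/gB//|_]; rewrite normr0.
have G0 x : ~ box3 M x -> G x = 0.
  by move=> nx; rewrite /G patchE; case: ifPn => // /set_mem xc; exact: g0.
have IG := integrable_box3 mG GB G0.
pose S := (g \o shear) \_ [set x | 0 < x.2].
have SE x : S x = G (shear x).
  rewrite /S /G !patchE; case: ifPn => [/set_mem/= x0|].
    by rewrite mem_set//; exact/upcone_shear.
  move=> nx; rewrite memNset// => /upcone_shear x0.
  by move/negP: nx; apply; rewrite inE.
have mS : measurable_fun setT (S : mR * mR * mR -> mR).
  apply: measurable_patch3; first exact: open_halfspace.
  move=> x /= x0; apply: continuous_comp; first exact: continuous_shear.
  by apply: cg; exact/upcone_shear.
have SB x : `|S x| <= B by rewrite SE.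
have S0 x : ~ box3 M x -> S x = 0.
  move=> nx; rewrite /S patchE; case: ifPn => // /set_mem /= x0.
  by apply: g0; [exact/upcone_shear|exact: box3_shear].
have IS := integrable_box3 mS SB S0.
have mC : measurable (upcone : set (mR * mR * mR)).
  by apply: open_measurable3; exact: open_upcone.
split; first by apply/(integrable_mkcond _ mC); rewrite GE.
rewrite integral_mkcond GE (fubini3_12 IG) (fubini3_12 IS).
apply: eq_integral => -[x y] _ /=.
rewrite -(@integral_translation _ (m * rho (x, y, 0))); last 2 first.
- apply/measurable_EFinP.
  exact: (measurableT_comp mG (measurable_pair1 (x, y))).
- have -> : (fun z => (EFin \o G) (x, y, m * rho (x, y, 0) + z)) =
      EFin \o (fun z => S (x, y, z)).
    by apply/funext => z; rewrite /= SE.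
  apply: (integrable_support (measurable_seg M) (seg_ltoo M)).
  + exact: (measurableT_comp mS (measurable_pair1 (x, y))).
  + by move=> z; exact: SB.
  + by move=> z nz; apply: S0 => -[].
by apply: eq_integral => z _; rewrite SE.
Qed.

(** The divergence is the sum of the two slanted derivatives and of the vertical
    derivative of the component transverse to the boundary, which vanishes on the
    boundary. *)
Lemma integral_divergence_upcone V1 V2 V3 :
  shellC1 V1 -> shellC1 V2 -> shellC1 V3 ->
  (forall x : R3 R, x.1.2 != 0 -> x.2 = 0 ->
    V3 (shear x) = m * (x.1.1 / rho x) * V1 (shear x)
                 + m * (x.1.2 / rho x) * V2 (shear x)) ->
  let divV x := 'D_e1 V1 x + 'D_e2 V2 x + 'D_e3 V3 x in
  lebesgue3.-integrable upcone (EFin \o divV) /\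
  (\int[lebesgue3]_(x in upcone) (divV x)%:E = 0)%E.
Proof.
move=> s1 s2 s3 bc divV.
have upcone0 x : upcone x -> 0 < x.2.
  by apply: le_lt_trans; rewrite mulr_ge0 ?rho_ge0// ltW.
have [B1 B10 HB1] := shellC1_bounded e1 s1.
have [B2 B20 HB2] := shellC1_bounded e2 s2.
have [B3 B30 HB3] := shellC1_bounded e3 s3.
have cD f v x : shellC1 f -> upcone x -> {for x, continuous ('D_v f)}.
  by move=> sf /upcone0 x0; have [[]] := sf x x0.
have [||||I ->] := @integral_shear divV (B1 + B2 + B3).
- move=> x xc; exact: (cvgD (cvgD (cD _ _ _ s1 xc) (cD _ _ _ s2 xc)) (cD _ _ _ s3 xc)).
- move=> x xc; have x0 := upcone0 x xc; have xc' := ltW xc.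
  apply: (le_trans (ler_normD _ _)); apply: lerD; last exact: HB3.
  by apply: (le_trans (ler_normD _ _)); apply: lerD; [exact: HB1|exact: HB2].
- by rewrite !addr_ge0.
- move=> x xc nx; have x0 := upcone0 x xc.
  have xM : M < `|x|.
    rewrite ltNge norm3_le; apply/negP => /and3P[x1 x2 x3].
    by apply: nx; split; [split|]; exact/segP.
  have D0 f v (sf : shellC1 f) := shellC1_derive0 v sf x0 (or_introl xM).
  by rewrite /divV !D0// !addr0.
split => //.
have [I1 E1] := integral_slanted1 s1; have [I2 E2] := integral_slanted2 s2.
have [I3 E3] := integral_vertical s1 s2 s3 bc.
pose A1 x := sheard V1 e1 x + m * (x.1.1 / rho x) * sheard V1 e3 x.
pose A2 x := sheard V2 e2 x + m * (x.1.2 / rho x) * sheard V2 e3 x.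
pose A3 x := sheard V3 e3 x - (m * (x.1.1 / rho x) * sheard V1 e3 x
   + m * (x.1.2 / rho x) * sheard V2 e3 x).
transitivity (\int[lebesgue3]_x ((A1 x)%:E + (A2 x)%:E + (A3 x)%:E))%E.
  apply: eq_integral => x _; rewrite -!EFinD /A1 /A2 /A3; congr _%:E.
  have -> : ((divV \o shear) \_ [set x | 0 < x.2]) x =
      sheard V1 e1 x + sheard V2 e2 x + sheard V3 e3 x.
    by rewrite /sheard !patchE; case: ifP => // _; rewrite !addr0.
  move: (sheard V1 e1 x) (sheard V2 e2 x) (sheard V3 e3 x) => a b c.
  move: (sheard V1 e3 x) (sheard V2 e3 x) => a' b'; ring.
rewrite integralD//; last exact: integrableD.
by rewrite integralD// E1 E2 E3 !adde0.
Qed.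

End ShellFunction.
End Cone.

(** * The trigonometric inequality *)

Section Trigonometry.
Context {R : realType}.
Implicit Types (b t w : R).

Lemma derive_ge0_ge0 (f f' : R -> R) b :
  (forall t, is_derive t (1 : R) f (f' t)) ->
  (forall t, 0 < t < b -> 0 <= f' t) -> f 0 = 0 ->
  forall t, 0 <= t <= b -> 0 <= f t.
Proof.
move=> df f'0 f0 t /andP[t0 tb].
move: t0; rewrite le_eqVlt => /predU1P[<-|t0]; first by rewrite f0.
have cf : {within `[0, t], continuous f}.
  by apply: derivable_within_continuous => s _; apply: ex_derive.
have [c /[!in_itv]/= /andP[c0 ct]] := MVT t0 (fun s _ => df s) cf.
rewrite f0 !subr0 => ->; rewrite mulr_ge0 ?(ltW t0)// f'0// c0.
exact: lt_le_trans tb.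
Qed.

Lemma sincos_ge0 t : 0 < t < pi / 2 -> (0 <= sin t) && (0 <= cos t).
Proof.
move=> /andP[t0 tp]; rewrite !ltW//; last by rewrite sin_gt0_pihalf// t0.
by rewrite cos_gt0_pihalf// tp (lt_trans _ t0)// oppr_lt0 divr_gt0 ?pi_gt0.
Qed.

(** Each of the next three functions vanishes at 0, and its derivative is the
    previous one up to a nonnegative factor; the first one has derivative
    [sin t + 2 t cos t]. *)
Lemma trig_ge1 t : 0 <= t <= pi / 2 -> 0 <= cos t - 1 + 2 * (t * sin t).
Proof.
move: t; apply: (@derive_ge0_ge0 (fun t => cos t - 1 + 2 * (t * sin t))
  (fun t => sin t + 2 * (t * cos t))).
- by move=> s; apply: is_derive_eq; rewrite /GRing.scale /=; ring.
- move=> s sp; have /andP[s0 c0] := sincos_ge0 sp; case/andP: sp => sp _.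
  by rewrite addr_ge0 ?mulr_ge0// ltW.
- by rewrite cos0 mul0r; ring.
Qed.

Lemma trig_ge2 t : 0 <= t <= pi / 2 -> 0 <= 3 * sin t - t * (1 + 2 * cos t).
Proof.
move: t; apply: (@derive_ge0_ge0 (fun t => 3 * sin t - t * (1 + 2 * cos t))
  (fun t => cos t - 1 + 2 * (t * sin t))).
- by move=> s; apply: is_derive_eq; rewrite /GRing.scale /=; ring.
- by move=> s /andP[s0 sp]; apply: trig_ge1; rewrite !ltW.
- by rewrite sin0; ring.
Qed.

Lemma trig_ge3 t : 0 <= t <= pi / 2 ->
  0 <= t * (1 + cos t + cos t ^+ 2) - sin t * (1 + 2 * cos t).
Proof.
move: t; apply: (@derive_ge0_ge0
  (fun t => t * (1 + cos t + cos t ^+ 2) - sin t * (1 + 2 * cos t))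
  (fun t => sin t * (3 * sin t - t * (1 + 2 * cos t)))).
- move=> s; apply: is_derive_eq; rewrite /GRing.scale /=.
  have := cos2Dsin2 s; nra.
- move=> s sp; have /andP[s0 _] := sincos_ge0 sp; case/andP: sp => sp s2.
  by rewrite mulr_ge0//; apply: trig_ge2; rewrite !ltW.
- by rewrite sin0; ring.
Qed.

(** The right-hand side decreases on ]0, pi / 2]: its derivative is the opposite
    of [trig_ge3] up to a positive factor. *)
Lemma pihalf_le w : 0 < w < pi / 2 ->
  (pi / 2) ^+ 2 <= (w / sin w) ^+ 2 * (1 + 2 * cos w).
Proof.
move=> /andP[w0 wp]; pose q t := (t / sin t) ^+ 2 * (1 + 2 * cos t).
have p0 : 0 < pi / 2 :> R by rewrite divr_gt0// pi_gt0.
have s0 t : w <= t <= pi / 2 -> 0 < sin t.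
  move=> /andP[wt tp]; apply: sin_gt0_pi; rewrite (lt_le_trans w0 wt)/=.
  by rewrite (le_lt_trans tp)// ltr_pdivrMr ?pi_gt0// ltr_pMr ?pi_gt0// ltr1n.
have dq t : w <= t <= pi / 2 -> is_derive t (1 : R) q
    (- (2 * t * (t * (1 + cos t + cos t ^+ 2) - sin t * (1 + 2 * cos t)))
      / sin t ^+ 3).
  move=> /s0 st; have st0 : sin t != 0 by rewrite gt_eqF.
  have D := is_deriveV st0 (is_derive_sin t).
  rewrite /q; apply: is_derive_eq; rewrite /GRing.scale /=.
  have -> : sin t ^- 2 = (sin t)^-1 ^+ 2 by rewrite exprVn.
  have -> : sin t ^- 3 = (sin t)^-1 ^+ 3 by rewrite exprVn.
  have := mulfV st0; have := cos2Dsin2 t.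
  move: (sin t) (sin t)^-1 (cos t) => s i c cs si.
  (* A combination of the relations [s * i = 1] and [c^2 + s^2 = 1]. *)
  apply/eqP; rewrite -subr_eq0; apply/eqP.
  transitivity ((s * i - 1) * (2 * t ^+ 2 * i ^+ 2 * s - 2 * (1 + 2 * c) * t * i ^+ 2)
    - 2 * t ^+ 2 * i ^+ 3 * (c ^+ 2 + s ^+ 2 - 1)); first by ring.
  by rewrite si cs !subrr mulr0 mul0r subrr.
have cq : {within `[w, pi / 2], continuous q}.
  apply: derivable_within_continuous => t; rewrite in_itv/= => /dq D.
  by apply: ex_derive.
have qp : q (pi / 2) = (pi / 2) ^+ 2.
  by rewrite /q sin_pihalf cos_pihalf divr1 mulr0 addr0 mulr1.
rewrite -qp -/(q w).
have dq' t : t \in `]w, pi / 2[ -> is_derive t (1 : R) q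
    (- (2 * t * (t * (1 + cos t + cos t ^+ 2) - sin t * (1 + 2 * cos t)))
      / sin t ^+ 3).
  by rewrite in_itv/= => /andP[t1 t2]; apply: dq; rewrite !ltW.
have [t] := MVT wp dq' cq.
rewrite in_itv/= => /andP[t1 t2] E; rewrite -subr_le0 E.
apply: mulr_le0_ge0; last by rewrite subr_ge0 ltW.
rewrite mulNr oppr_le0 divr_ge0//.
  have t0 := lt_trans w0 t1.
  by rewrite !mulr_ge0 ?(ltW t0)// trig_ge3// !ltW.
by rewrite exprn_ge0// ltW// s0// !ltW.
Qed.

(** The right-hand side is the constant that the Hardy weight of [slope_riccati]
    produces. *)
Lemma aperture_le w : 0 < w < pi / 2 ->
  (pi / (4 * w)) ^+ 2 <= (1 + 2 * cos w) / (4 * sin w ^+ 2).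
Proof.
move=> /andP[w0 wp]; have := pihalf_le (introT andP (conj w0 wp)).
have s0 : 0 < sin w by rewrite sin_gt0_pihalf// w0.
have -> : pi / (4 * w) = pi / 2 * (2 * w)^-1.
  by field; rewrite gt_eqF.
have -> : (1 + 2 * cos w) / (4 * sin w ^+ 2) =
    (w / sin w) ^+ 2 * (1 + 2 * cos w) * (2 * w)^-1 ^+ 2.
  by field; rewrite !gt_eqF.
by rewrite [X in _ -> X <= _]exprMn => H; rewrite ler_wpM2r// sqr_ge0.
Qed.

End Trigonometry.

(** * Algebra of the boundary condition *)

Section BoundaryAlgebra.
Context {R : comRingType}.

(** Real and imaginary parts of the two components of [i (n . sigma) eta], where
    [eta = (p + i q, s + i t)]. *)
Definition isig1 (n1 n2 n3 p q s t : R) := - (n3 * q + n1 * t - n2 * s).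
Definition isig2 (n1 n2 n3 p q s t : R) := n3 * p + n1 * s + n2 * t.
Definition isig3 (n1 n2 n3 p q s t : R) := - (n1 * q + n2 * p - n3 * t).
Definition isig4 (n1 n2 n3 p q s t : R) := n1 * p - n2 * q - n3 * s.

Definition wr (a b a' b' : R) := a * b' - b * a'.

(** The flux [n . W] of the null Lagrangian of a Weyl spinor. It only involves
    derivatives along the two tangent vectors that project onto the horizontal
    axes; these derivatives carry the indices 1 and 2. *)
Definition nflux (n1 n2 n3 p q s t p1 q1 s1 t1 p2 q2 s2 t2 : R) :=
  n3 * wr p s p1 s1 + n3 * wr p t p2 t2
  + (n1 * wr s t s2 t2 - n2 * wr s t s1 t1)
  + n3 * wr q t q1 t1 - n3 * wr q s q2 s2
  - (n1 * wr p q p2 q2 - n2 * wr p q p1 q1).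

(** Conjugation by [n . sigma] reflects the tangent plane, which reverses the
    orientation. *)
Lemma nflux_isig (n1 n2 n3 p q s t p1 q1 s1 t1 p2 q2 s2 t2 : R) :
  nflux n1 n2 n3
    (isig1 n1 n2 n3 p q s t) (isig2 n1 n2 n3 p q s t)
    (isig3 n1 n2 n3 p q s t) (isig4 n1 n2 n3 p q s t)
    (isig1 n1 n2 n3 p1 q1 s1 t1) (isig2 n1 n2 n3 p1 q1 s1 t1)
    (isig3 n1 n2 n3 p1 q1 s1 t1) (isig4 n1 n2 n3 p1 q1 s1 t1)
    (isig1 n1 n2 n3 p2 q2 s2 t2) (isig2 n1 n2 n3 p2 q2 s2 t2)
    (isig3 n1 n2 n3 p2 q2 s2 t2) (isig4 n1 n2 n3 p2 q2 s2 t2)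
  = - (n1 ^+ 2 + n2 ^+ 2 + n3 ^+ 2) *
    nflux n1 n2 n3 p q s t p1 q1 s1 t1 p2 q2 s2 t2.
Proof. rewrite /nflux /wr /isig1 /isig2 /isig3 /isig4; ring. Qed.

(** With [(C c1, C c2, - S)] the normal of the cone, [k1 (c2, - c1, 0)] and
    [k2 (c2, - c1, 0)] are its derivatives along the two tangent vectors. *)
Lemma nflux_curvature (C S c1 c2 k p q s t : R) :
  let n1 := C * c1 in let n2 := C * c2 in let n3 := - S in
  let k1 := k * c2 in let k2 := - (k * c1) in
  nflux n1 n2 n3
    (isig1 n1 n2 n3 p q s t) (isig2 n1 n2 n3 p q s t)
    (isig3 n1 n2 n3 p q s t) (isig4 n1 n2 n3 p q s t)
    (isig1 (k1 * c2) (- (k1 * c1)) 0 p q s t) (isig2 (k1 * c2) (- (k1 * c1)) 0 p q s t)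
    (isig3 (k1 * c2) (- (k1 * c1)) 0 p q s t) (isig4 (k1 * c2) (- (k1 * c1)) 0 p q s t)
    (isig1 (k2 * c2) (- (k2 * c1)) 0 p q s t) (isig2 (k2 * c2) (- (k2 * c1)) 0 p q s t)
    (isig3 (k2 * c2) (- (k2 * c1)) 0 p q s t) (isig4 (k2 * c2) (- (k2 * c1)) 0 p q s t)
  = k * (c1 ^+ 2 + c2 ^+ 2) * (S ^+ 2 + C ^+ 2 * (c1 ^+ 2 + c2 ^+ 2))
      * (p ^+ 2 + q ^+ 2 + s ^+ 2 + t ^+ 2).
Proof. rewrite /nflux /wr /isig1 /isig2 /isig3 /isig4 /=; ring. Qed.

Lemma nfluxD (n1 n2 n3 p q s t p1 q1 s1 t1 p2 q2 s2 t2
    p1' q1' s1' t1' p2' q2' s2' t2' : R) :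
  nflux n1 n2 n3 p q s t (p1 + p1') (q1 + q1') (s1 + s1') (t1 + t1')
    (p2 + p2') (q2 + q2') (s2 + s2') (t2 + t2') =
  nflux n1 n2 n3 p q s t p1 q1 s1 t1 p2 q2 s2 t2
  + nflux n1 n2 n3 p q s t p1' q1' s1' t1' p2' q2' s2' t2'.
Proof. rewrite /nflux /wr; ring. Qed.

Lemma isig_sqr (n1 n2 n3 p q s t : R) : n1 ^+ 2 + n2 ^+ 2 + n3 ^+ 2 = 1 ->
  isig1 n1 n2 n3 p q s t ^+ 2 + isig2 n1 n2 n3 p q s t ^+ 2
  + isig3 n1 n2 n3 p q s t ^+ 2 + isig4 n1 n2 n3 p q s t ^+ 2 =
  p ^+ 2 + q ^+ 2 + s ^+ 2 + t ^+ 2.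
Proof.
move=> n; rewrite -[RHS]mul1r -n /isig1 /isig2 /isig3 /isig4; ring.
Qed.

End BoundaryAlgebra.

(** * The square of the Dirac operator up to a divergence *)

Section Flux.
Context {R : realType}.
Implicit Types (a b p q s t f : R3 R -> R) (x v w : R3 R).

Lemma smooth_D1 f : smooth f -> smooth ('D_e1 f).
Proof. by move=> sf; rewrite -basis3_e1; exact: smooth_derive. Qed.
Lemma smooth_D2 f : smooth f -> smooth ('D_e2 f).
Proof. by move=> sf; rewrite -basis3_e2; exact: smooth_derive. Qed.
Lemma smooth_D3 f : smooth f -> smooth ('D_e3 f).
Proof. by move=> sf; rewrite -basis3_e3; exact: smooth_derive. Qed.

Lemma smooth_D21 f x : smooth f -> 'D_e2 ('D_e1 f) x = 'D_e1 ('D_e2 f) x.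
Proof. by move=> sf; rewrite -basis3_e1 -basis3_e2; exact: smooth_derive_comm. Qed.
Lemma smooth_D31 f x : smooth f -> 'D_e3 ('D_e1 f) x = 'D_e1 ('D_e3 f) x.
Proof. by move=> sf; rewrite -basis3_e1 -basis3_e3; exact: smooth_derive_comm. Qed.
Lemma smooth_D32 f x : smooth f -> 'D_e3 ('D_e2 f) x = 'D_e2 ('D_e3 f) x.
Proof. by move=> sf; rewrite -basis3_e2 -basis3_e3; exact: smooth_derive_comm. Qed.

Definition bracket a b v x : R := wr (a x) (b x) ('D_v a x) ('D_v b x).

Lemma is_derive_bracket a b v w x : C1 a x -> C1 b x ->
  C1 ('D_v a) x -> C1 ('D_v b) x ->
  is_derive x w (bracket a b v)
    ('D_w a x * 'D_v b x - 'D_w b x * 'D_v a x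
     + (a x * 'D_w ('D_v b) x - b x * 'D_w ('D_v a) x)).
Proof.
move=> Ca Cb Cva Cvb.
have Da := derivableP (@C1_derivable _ _ _ w Ca); have Db := derivableP (@C1_derivable _ _ _ w Cb).
have Dva := derivableP (@C1_derivable _ _ _ w Cva).
have Dvb := derivableP (@C1_derivable _ _ _ w Cvb).
apply: (is_derive_eq (is_deriveB (is_deriveM Da Dvb) (is_deriveM Db Dva))).
rewrite /GRing.scale /=.
move: ('D_w a x) ('D_w b x) ('D_w ('D_v a) x) ('D_w ('D_v b) x) ('D_v a x) ('D_v b x).
by move: (a x) (b x) => a0 b0 aw bw avw bvw av bv; ring.
Qed.

Lemma C1_bracket a b v x : C1 a x -> C1 b x -> C1 ('D_v a) x -> C1 ('D_v b) x ->
  C1 (bracket a b v) x.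
Proof. by move=> *; apply: C1B; exact: C1M. Qed.

Lemma C1_bracket1 a b x : smooth a -> smooth b -> C1 (bracket a b e1) x.
Proof.
move=> sa sb; exact: (C1_bracket (smooth_C1 x sa) (smooth_C1 x sb)
  (smooth_C1 x (smooth_D1 sa)) (smooth_C1 x (smooth_D1 sb))).
Qed.

Lemma C1_bracket2 a b x : smooth a -> smooth b -> C1 (bracket a b e2) x.
Proof.
move=> sa sb; exact: (C1_bracket (smooth_C1 x sa) (smooth_C1 x sb)
  (smooth_C1 x (smooth_D2 sa)) (smooth_C1 x (smooth_D2 sb))).
Qed.

Lemma C1_bracket3 a b x : smooth a -> smooth b -> C1 (bracket a b e3) x.
Proof.
move=> sa sb; exact: (C1_bracket (smooth_C1 x sa) (smooth_C1 x sb)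
  (smooth_C1 x (smooth_D3 sa)) (smooth_C1 x (smooth_D3 sb))).
Qed.

(** The matrices [sigma_j sigma_k], [j <> k], are antihermitian, so in
    [|sigma . grad xi|^2] the cross terms are Jacobians [{f, g}_jk] of the four
    real components of [xi], each of which is the divergence of a bracket. *)
Definition flux1 p q s t x : R := - bracket p s e3 x + bracket s t e2 x
  - bracket q t e3 x - bracket p q e2 x.
Definition flux2 p q s t x : R := - bracket p t e3 x - bracket s t e1 x
  + bracket q s e3 x + bracket p q e1 x.
Definition flux3 p q s t x : R := bracket p s e1 x + bracket p t e2 x
  + bracket q t e1 x - bracket q s e2 x.

(** [|sigma . grad xi|^2] for the two-component spinor
    [xi = (p + i q, s + i t)]. *)
Definition weyl_sqr p q s t x : R :=
    ('D_e3 p x + 'D_e1 s x + 'D_e2 t x) ^+ 2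
  + ('D_e3 q x + 'D_e1 t x - 'D_e2 s x) ^+ 2
  + ('D_e1 p x - 'D_e2 q x - 'D_e3 s x) ^+ 2
  + ('D_e1 q x + 'D_e2 p x - 'D_e3 t x) ^+ 2.

Definition grad_sqr f x : R := 'D_e1 f x ^+ 2 + 'D_e2 f x ^+ 2 + 'D_e3 f x ^+ 2.

(** The second derivatives cancel by symmetry; the indices stand for derivatives. *)
Lemma null_lagrangian (
    p p1 p2 p3 p12 p21 p13 p31 p23 p32
    q q1 q2 q3 q12 q21 q13 q31 q23 q32
    s s1 s2 s3 s12 s21 s13 s31 s23 s32
    t t1 t2 t3 t12 t21 t13 t31 t23 t32
    : R) :
  p21 = p12 -> p31 = p13 -> p32 = p23 ->
  q21 = q12 -> q31 = q13 -> q32 = q23 ->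
  s21 = s12 -> s31 = s13 -> s32 = s23 ->
  t21 = t12 -> t31 = t13 -> t32 = t23 ->
  (- (p1 * s3 - s1 * p3 + (p * s13 - s * p13)) + (s1 * t2 - t1 * s2 + (s * t12 - t * s12))
    - (q1 * t3 - t1 * q3 + (q * t13 - t * q13)) - (p1 * q2 - q1 * p2 + (p * q12 - q * p12)))
  + (- (p2 * t3 - t2 * p3 + (p * t23 - t * p23)) - (s2 * t1 - t2 * s1 + (s * t21 - t * s21))
    + (q2 * s3 - s2 * q3 + (q * s23 - s * q23)) + (p2 * q1 - q2 * p1 + (p * q21 - q * p21)))
  + ((p3 * s1 - s3 * p1 + (p * s31 - s * p31)) + (p3 * t2 - t3 * p2 + (p * t32 - t * p32))
    + (q3 * t1 - t3 * q1 + (q * t31 - t * q31)) - (q3 * s2 - s3 * q2 + (q * s32 - s * q32)))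
  = (p3 + s1 + t2) ^+ 2 + (q3 + t1 - s2) ^+ 2 + (p1 - q2 - s3) ^+ 2
    + (q1 + p2 - t3) ^+ 2
    - (p1 ^+ 2 + p2 ^+ 2 + p3 ^+ 2 + (q1 ^+ 2 + q2 ^+ 2 + q3 ^+ 2)
       + (s1 ^+ 2 + s2 ^+ 2 + s3 ^+ 2) + (t1 ^+ 2 + t2 ^+ 2 + t3 ^+ 2)).
Proof. by do 12!move=> ->; ring. Qed.

Section Smooth4.
Variables (p q s t : R3 R -> R).
Hypotheses (sp : smooth p) (sq : smooth q) (ss : smooth s) (st : smooth t).

Lemma C1_flux1 x : C1 (flux1 p q s t) x.
Proof.
exact: (C1B (C1B (C1D (C1N (C1_bracket3 x sp ss)) (C1_bracket2 x ss st))
  (C1_bracket3 x sq st)) (C1_bracket2 x sp sq)).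
Qed.

Lemma C1_flux2 x : C1 (flux2 p q s t) x.
Proof.
exact: (C1D (C1D (C1B (C1N (C1_bracket3 x sp st)) (C1_bracket1 x ss st))
  (C1_bracket3 x sq ss)) (C1_bracket1 x sp sq)).
Qed.

Lemma C1_flux3 x : C1 (flux3 p q s t) x.
Proof.
exact: (C1B (C1D (C1D (C1_bracket1 x sp ss) (C1_bracket2 x sp st))
  (C1_bracket1 x sq st)) (C1_bracket2 x sq ss)).
Qed.

Lemma divergence_flux x :
  'D_e1 (flux1 p q s t) x + 'D_e2 (flux2 p q s t) x + 'D_e3 (flux3 p q s t) x
  = weyl_sqr p q s t x
    - (grad_sqr p x + grad_sqr q x + grad_sqr s x + grad_sqr t x).
Proof.
have B1 a b w : smooth a -> smooth b -> is_derive x w (bracket a b e1) _ :=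
  fun sa sb => @is_derive_bracket a b e1 w x (smooth_C1 x sa) (smooth_C1 x sb)
    (smooth_C1 x (smooth_D1 sa)) (smooth_C1 x (smooth_D1 sb)).
have B2 a b w : smooth a -> smooth b -> is_derive x w (bracket a b e2) _ :=
  fun sa sb => @is_derive_bracket a b e2 w x (smooth_C1 x sa) (smooth_C1 x sb)
    (smooth_C1 x (smooth_D2 sa)) (smooth_C1 x (smooth_D2 sb)).
have B3 a b w : smooth a -> smooth b -> is_derive x w (bracket a b e3) _ :=
  fun sa sb => @is_derive_bracket a b e3 w x (smooth_C1 x sa) (smooth_C1 x sb)
    (smooth_C1 x (smooth_D3 sa)) (smooth_C1 x (smooth_D3 sb)).
have [_ ->] := is_deriveB (is_deriveB (is_deriveD (is_deriveN (B3 p s e1 sp ss))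
  (B2 s t e1 ss st)) (B3 q t e1 sq st)) (B2 p q e1 sp sq).
have [_ ->] := is_deriveD (is_deriveD (is_deriveB (is_deriveN (B3 p t e2 sp st))
  (B1 s t e2 ss st)) (B3 q s e2 sq ss)) (B1 p q e2 sp sq).
have [_ ->] := is_deriveB (is_deriveD (is_deriveD (B1 p s e3 sp ss)
  (B2 p t e3 sp st)) (B1 q t e3 sq st)) (B2 q s e3 sq ss).
by apply: null_lagrangian;
  [exact: smooth_D21|exact: smooth_D31|exact: smooth_D32
  |exact: smooth_D21|exact: smooth_D31|exact: smooth_D32
  |exact: smooth_D21|exact: smooth_D31|exact: smooth_D32
  |exact: smooth_D21|exact: smooth_D31|exact: smooth_D32].
Qed.

End Smooth4.
End Flux.

(** * A Hardy weight for the cone *)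

Section Hardy.
Context {R : realType} (b : R).
Implicit Types (f p q s t : R3 R -> R) (x v : R3 R).

Definition erad x : R := Num.sqrt (x.1.1 ^+ 2 + x.1.2 ^+ 2 + x.2 ^+ 2).

(** The slope is the gradient of [- (1/2 + b) ln |x| + b ln (|x| + x3)], that is
    the logarithmic gradient of a positive function, homogeneous of degree [-1/2]
    as in the Hardy inequality of the whole space; [b] tunes its decay from the
    axis to the boundary of the cone. *)
Definition slopeQ x : R := - (2^-1 + b) * ((erad x)^-1 * (erad x)^-1)
  + b * ((erad x)^-1 * (erad x + x.2)^-1).
Definition slope1 x : R := x.1.1 * slopeQ x.
Definition slope2 x : R := x.1.2 * slopeQ x.
Definition slope3 x : R :=
  x.2 * (- (2^-1 + b) * ((erad x)^-1 * (erad x)^-1)) + b * (erad x)^-1.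

Lemma erad_gt0 x : 0 < x.2 -> 0 < erad x.
Proof.
move=> x0; rewrite /erad sqrtr_gt0 ltr_wpDl ?exprn_gt0//.
by rewrite addr_ge0 ?sqr_ge0.
Qed.

Lemma sqr_erad x : erad x ^+ 2 = x.1.1 ^+ 2 + x.1.2 ^+ 2 + x.2 ^+ 2.
Proof. by rewrite sqr_sqrtr// !addr_ge0 ?sqr_ge0. Qed.

Lemma is_deriveV3 f x v (d : R) : f x != 0 -> is_derive x v f d ->
  is_derive x v (fun y => (f y)^-1) (- (f x) ^- 2 * d).
Proof.
by move=> fx [df <-]; split; [exact: derivableV|rewrite deriveV].
Qed.

Lemma coord1_lin3 : (fun y : R3 R => y.1.1) = lin3 1 0 0.
Proof. by apply/funext => y; rewrite /lin3 !mulr0 !addr0 mulr1. Qed.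
Lemma coord2_lin3 : (fun y : R3 R => y.1.2) = lin3 0 1 0.
Proof. by apply/funext => y; rewrite /lin3 !mulr0 add0r addr0 mulr1. Qed.
Lemma coord3_lin3 : (fun y : R3 R => y.2) = lin3 0 0 1.
Proof. by apply/funext => y; rewrite /lin3 !mulr0 !add0r mulr1. Qed.

Lemma is_derive_lin3 (a1 a2 a3 : R) x v :
  is_derive x v (lin3 a1 a2 a3) (lin3 a1 a2 a3 v).
Proof.
have [D E] := lin3_is_diff a1 a2 a3 x.
by split; [exact: diff_derivable|rewrite deriveE// E].
Qed.

Lemma is_derive_coord1 x v : is_derive x v (fun y : R3 R => y.1.1) v.1.1.
Proof.
rewrite coord1_lin3 (_ : v.1.1 = lin3 1 0 0 v); first exact: is_derive_lin3.
by rewrite -coord1_lin3.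
Qed.
Lemma is_derive_coord2 x v : is_derive x v (fun y : R3 R => y.1.2) v.1.2.
Proof.
rewrite coord2_lin3 (_ : v.1.2 = lin3 0 1 0 v); first exact: is_derive_lin3.
by rewrite -coord2_lin3.
Qed.
Lemma is_derive_coord3 x v : is_derive x v (fun y : R3 R => y.2) v.2.
Proof.
rewrite coord3_lin3 (_ : v.2 = lin3 0 0 1 v); first exact: is_derive_lin3.
by rewrite -coord3_lin3.
Qed.

Lemma C1_coord1 x : C1 (fun y : R3 R => y.1.1) x.
Proof. by rewrite coord1_lin3; exact: C1_lin3. Qed.
Lemma C1_coord2 x : C1 (fun y : R3 R => y.1.2) x.
Proof. by rewrite coord2_lin3; exact: C1_lin3. Qed.
Lemma C1_coord3 x : C1 (fun y : R3 R => y.2) x.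
Proof. by rewrite coord3_lin3; exact: C1_lin3. Qed.

Section AtPoint.
Variable x : R3 R.
Hypothesis x0 : 0 < x.2.

Let r0 : erad x != 0. Proof. by rewrite gt_eqF// erad_gt0. Qed.
Let rx0 : erad x + x.2 != 0. Proof. by rewrite gt_eqF// addr_gt0// erad_gt0. Qed.
Let s0 : 0 < x.1.1 ^+ 2 + x.1.2 ^+ 2 + x.2 ^+ 2.
Proof. by have := erad_gt0 x0; rewrite /erad sqrtr_gt0. Qed.

Lemma C1_erad : C1 erad x.
Proof.
have c1 := C1_coord1 x; have c2 := C1_coord2 x; have c3 := C1_coord3 x.
exact: (C1_sqrt s0 (C1D (C1D (C1M c1 c1) (C1M c2 c2)) (C1M c3 c3))).
Qed.

Lemma C1_slopeQ : C1 slopeQ x.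
Proof.
have Cr := C1_erad; have Ci := C1V r0 Cr.
have Cj := C1V rx0 (C1D Cr (C1_coord3 x)).
exact: (C1D (C1M (C1_cst _ _) (C1M Ci Ci)) (C1M (C1_cst _ _) (C1M Ci Cj))).
Qed.

Lemma C1_slope1 : C1 slope1 x. Proof. exact: (C1M (C1_coord1 x) C1_slopeQ). Qed.
Lemma C1_slope2 : C1 slope2 x. Proof. exact: (C1M (C1_coord2 x) C1_slopeQ). Qed.
Lemma C1_slope3 : C1 slope3 x.
Proof.
have Ci := C1V r0 C1_erad.
exact: (C1D (C1M (C1_coord3 x) (C1M (C1_cst _ _) (C1M Ci Ci)))
  (C1M (C1_cst _ _) Ci)).
Qed.

Definition dot3 (u v : R3 R) : R := u.1.1 * v.1.1 + u.1.2 * v.1.2 + u.2 * v.2.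

Lemma is_derive_erad v : is_derive x v erad (dot3 x v * (erad x)^-1).
Proof.
have c1 := is_derive_coord1 x v; have c2 := is_derive_coord2 x v.
have c3 := is_derive_coord3 x v.
have D := is_deriveD (is_deriveD (is_deriveM c1 c1) (is_deriveM c2 c2))
  (is_deriveM c3 c3).
have C := C1D (C1D (C1M (C1_coord1 x) (C1_coord1 x))
  (C1M (C1_coord2 x) (C1_coord2 x))) (C1M (C1_coord3 x) (C1_coord3 x)).
split; first exact: (@C1_derivable _ _ _ v C1_erad).
have E : erad = Num.sqrt \o (fun y : R3 R => y.1.1 * y.1.1 + y.1.2 * y.1.2 + y.2 * y.2).
  by apply/funext => y; rewrite /erad !expr2.
rewrite [X in 'D_v X x]E derive_comp1; last 2 first.
- by rewrite -!expr2; case: (is_derive1_sqrt s0).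
- exact: C1_differentiable C.
rewrite -!expr2 derive_sqrt// -/(erad x) (@derive_val _ _ _ _ _ _ _ D).
by rewrite /GRing.scale /dot3/=; field.
Qed.

Lemma is_derive_irad v : is_derive x v (fun y => (erad y)^-1)
  (- dot3 x v * (erad x)^-1 ^+ 3).
Proof.
apply: (is_derive_eq (is_deriveV3 r0 (is_derive_erad v))).
by rewrite /GRing.scale /=; field.
Qed.

Lemma is_derive_irad3 v : is_derive x v (fun y => (erad y + y.2)^-1)
  (- (dot3 x v * (erad x)^-1 + v.2) * (erad x + x.2)^-1 ^+ 2).
Proof.
apply: (is_derive_eq (is_deriveV3 rx0 (is_deriveD (is_derive_erad v)
  (is_derive_coord3 x v)))).
by rewrite /GRing.scale /= exprVn mulNr mulNr mulrC.
Qed.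

(** [ln (|x| + x3)] is harmonic, so only the radial part has a divergence. *)
Lemma divergence_slope : 'D_e1 slope1 x + 'D_e2 slope2 x + 'D_e3 slope3 x =
  - (2^-1 + b) * (erad x)^-1 ^+ 2.
Proof.
pose P (y : R3 R) : R := - (2^-1 + b) * ((erad y)^-1 * (erad y)^-1).
have DP v : is_derive x v P ((2^-1 + b) * (2 * dot3 x v * (erad x)^-1 ^+ 4)).
  apply: (is_derive_eq (is_deriveZ (- (2^-1 + b))
    (is_deriveM (is_derive_irad v) (is_derive_irad v)))).
  by rewrite /GRing.scale /=; move: (dot3 x v) (erad x)^-1 => d i; ring.
have DQ v : is_derive x v slopeQ ((2^-1 + b) * (2 * dot3 x v * (erad x)^-1 ^+ 4)
    - b * (dot3 x v * (erad x)^-1 ^+ 3 * (erad x + x.2)^-1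
        + (erad x)^-1 * (dot3 x v * (erad x)^-1 + v.2) * (erad x + x.2)^-1 ^+ 2)).
  apply: (is_derive_eq (is_deriveD (DP v)
    (is_deriveZ b (is_deriveM (is_derive_irad v) (is_derive_irad3 v))))).
  rewrite /GRing.scale /=.
  by move: (dot3 x v) (erad x)^-1 (_ + _)^-1 => d i j; ring.
have [_ ->] := is_deriveM (is_derive_coord1 x e1) (DQ e1).
have [_ ->] := is_deriveM (is_derive_coord2 x e2) (DQ e2).
have [_ ->] := is_deriveD (is_deriveM (is_derive_coord3 x e3) (DP e3))
  (is_deriveZ b (is_derive_irad e3)).
rewrite /P /slopeQ.
rewrite /GRing.scale /= /dot3 /= !mulr0 !mulr1 !addr0 !add0r.
have := sqr_erad x; move: r0 rx0; move: (erad x) (x.1.1) (x.1.2) (x.2).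
move=> r x1 x2 x3 rn0 rxn0 E.
(* Off the identity [r^2 = |x|^2] both sides differ by a multiple of it. *)
apply/eqP; rewrite -subr_eq0; apply/eqP.
transitivity ((x1 ^+ 2 + x2 ^+ 2 + x3 ^+ 2 - r ^+ 2) *
  (2 * (2^-1 + b) * r^-1 ^+ 4
   - b * (r^-1 ^+ 3 * (r + x3)^-1 + r^-1 ^+ 2 * (r + x3)^-1 ^+ 2))).
  by field; rewrite rn0 rxn0.
by rewrite E subrr mul0r.
Qed.

Lemma sqr_slope : slope1 x ^+ 2 + slope2 x ^+ 2 + slope3 x ^+ 2 =
  ((2^-1 + b) ^+ 2 - 2 * (2^-1 + b) * b) * (erad x)^-1 ^+ 2
  + 2 * b ^+ 2 * ((erad x)^-1 * (erad x + x.2)^-1).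
Proof.
rewrite /slope1 /slope2 /slope3 /slopeQ.
have := sqr_erad x; move: r0 rx0; move: (erad x) (x.1.1) (x.1.2) (x.2).
move=> r x1 x2 x3 rn0 rxn0 E.
apply/eqP; rewrite -subr_eq0; apply/eqP.
transitivity ((x1 ^+ 2 + x2 ^+ 2 + x3 ^+ 2 - r ^+ 2) *
  (- (2^-1 + b) * (r^-1 * r^-1) + b * (r^-1 * (r + x3)^-1)) ^+ 2).
  by field; rewrite rn0 rxn0.
by rewrite E subrr mul0r.
Qed.

(** The inequality [- Delta H >= k H / |x|^2] for the weight [H] with logarithmic
    gradient the slope. With [z = x3 / |x|] the left-hand side is, up to
    the factor [- 1 / |x|^2], the quantity
    [1/4 + b - b^2 (1 - z) / (1 + z) - k], which increases with [z]; at the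
    boundary [z = C] it is nonnegative by the choice of [b]. *)
Lemma slope_riccati (C k : R) : 0 <= C < 1 -> b = C / (2 * (1 - C)) ->
  C * erad x <= x.2 -> k <= (1 + 2 * C) / (4 * (1 - C ^+ 2)) ->
  'D_e1 slope1 x + 'D_e2 slope2 x + 'D_e3 slope3 x
  + (slope1 x ^+ 2 + slope2 x ^+ 2 + slope3 x ^+ 2) + k * (erad x)^-1 ^+ 2 <= 0.
Proof.
move=> /andP[C0 C1] bE xC kC; rewrite divergence_slope sqr_slope.
have rp := erad_gt0 x0; have C1' : 0 < 1 - C by rewrite subr_gt0.
have C1p : 0 < 1 + C by rewrite ltr_wpDr.
have jp : 0 < erad x + x.2 by rewrite addr_gt0.
have jC : erad x * (erad x + x.2)^-1 <= (1 + C)^-1.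
  by rewrite ler_pdivrMr// ler_pdivlMl// mulrDl mul1r lerD2l.
have -> : - (2^-1 + b) * (erad x)^-1 ^+ 2
    + (((2^-1 + b) ^+ 2 - 2 * (2^-1 + b) * b) * (erad x)^-1 ^+ 2
      + 2 * b ^+ 2 * ((erad x)^-1 * (erad x + x.2)^-1)) + k * (erad x)^-1 ^+ 2
  = (erad x)^-1 ^+ 2 * (k - (4^-1 + b + b ^+ 2
      - 2 * b ^+ 2 * (erad x * (erad x + x.2)^-1))).
  by field; rewrite r0 rx0.
rewrite mulr_ge0_le0 ?exprn_ge0 ?invr_ge0 ?(ltW rp)// subr_le0.
apply: (le_trans kC).
have -> : (1 + 2 * C) / (4 * (1 - C ^+ 2)) =
    4^-1 + b + b ^+ 2 - 2 * b ^+ 2 * (1 + C)^-1.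
  rewrite bE (_ : 1 - C ^+ 2 = (1 - C) * (1 + C)); last by ring.
  by field; rewrite !gt_eqF.
by rewrite lerD2l lerN2 ler_wpM2l// mulr_ge0 ?sqr_ge0.
Qed.

(** Completing the square in [|grad a - a X|^2]. *)
Lemma hardy_component (a a1 a2 a3 X1 X2 X3 D K : R) :
  D + (X1 ^+ 2 + X2 ^+ 2 + X3 ^+ 2) + K <= 0 ->
  K * a ^+ 2 <= a1 ^+ 2 + a2 ^+ 2 + a3 ^+ 2
    - (a ^+ 2 * D + 2 * a * (a1 * X1 + a2 * X2 + a3 * X3)).
Proof.
move=> H; rewrite -subr_ge0.
have -> : a1 ^+ 2 + a2 ^+ 2 + a3 ^+ 2
    - (a ^+ 2 * D + 2 * a * (a1 * X1 + a2 * X2 + a3 * X3)) - K * a ^+ 2 =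
  (a1 - a * X1) ^+ 2 + (a2 - a * X2) ^+ 2 + (a3 - a * X3) ^+ 2
  + a ^+ 2 * - (D + (X1 ^+ 2 + X2 ^+ 2 + X3 ^+ 2) + K) by ring.
by rewrite !addr_ge0 ?sqr_ge0// mulr_ge0 ?sqr_ge0// oppr_ge0.
Qed.

End AtPoint.

Definition dens p q s t x : R := p x * p x + q x * q x + s x * s x + t x * t x.
(** The null Lagrangian flux corrected by [|xi|^2 X], where [X] is the slope. *)
Definition field1 p q s t x : R := flux1 p q s t x + dens p q s t x * slope1 x.
Definition field2 p q s t x : R := flux2 p q s t x + dens p q s t x * slope2 x.
Definition field3 p q s t x : R := flux3 p q s t x + dens p q s t x * slope3 x.

Lemma bracket_eq0 f g v x : f x = 0 -> g x = 0 -> bracket f g v x = 0.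
Proof. by rewrite /bracket /wr => -> ->; rewrite !mul0r subrr. Qed.

Lemma dens_eq0 p q s t x : p x = 0 -> q x = 0 -> s x = 0 -> t x = 0 ->
  dens p q s t x = 0.
Proof. by rewrite /dens => -> -> -> ->; rewrite mul0r !addr0. Qed.

Lemma field1_eq0 p q s t x : p x = 0 -> q x = 0 -> s x = 0 -> t x = 0 ->
  field1 p q s t x = 0.
Proof.
move=> hp hq hs ht; rewrite /field1 /flux1 (dens_eq0 hp hq hs ht) mul0r addr0.
rewrite (bracket_eq0 e3 hp hs) (bracket_eq0 e2 hs ht) (bracket_eq0 e3 hq ht) (bracket_eq0 e2 hp hq).
by rewrite ?oppr0 !(addr0, subr0).
Qed.

Lemma field2_eq0 p q s t x : p x = 0 -> q x = 0 -> s x = 0 -> t x = 0 ->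
  field2 p q s t x = 0.
Proof.
move=> hp hq hs ht; rewrite /field2 /flux2 (dens_eq0 hp hq hs ht) mul0r addr0.
rewrite (bracket_eq0 e3 hp ht) (bracket_eq0 e1 hs ht) (bracket_eq0 e3 hq hs) (bracket_eq0 e1 hp hq).
by rewrite ?oppr0 !(addr0, subr0).
Qed.

Lemma field3_eq0 p q s t x : p x = 0 -> q x = 0 -> s x = 0 -> t x = 0 ->
  field3 p q s t x = 0.
Proof.
move=> hp hq hs ht; rewrite /field3 /flux3 (dens_eq0 hp hq hs ht) mul0r addr0.
rewrite (bracket_eq0 e1 hp hs) (bracket_eq0 e2 hp ht) (bracket_eq0 e1 hq ht) (bracket_eq0 e2 hq hs).
by rewrite ?oppr0 !(addr0, subr0).
Qed.

Section Half.
Variables (p q s t : R3 R -> R).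
Hypotheses (sp : smooth p) (sq : smooth q) (ss : smooth s) (st : smooth t).

Lemma C1_dens x : C1 (dens p q s t) x.
Proof.
have Cp := smooth_C1 x sp; have Cq := smooth_C1 x sq.
have Cs := smooth_C1 x ss; have Ct := smooth_C1 x st.
exact: (C1D (C1D (C1D (C1M Cp Cp) (C1M Cq Cq)) (C1M Cs Cs)) (C1M Ct Ct)).
Qed.

Lemma is_derive_dens x v : is_derive x v (dens p q s t)
  (2 * p x * 'D_v p x + 2 * q x * 'D_v q x + 2 * s x * 'D_v s x
   + 2 * t x * 'D_v t x).
Proof.
have Dp := derivableP (@C1_derivable _ _ _ v (smooth_C1 x sp)).
have Dq := derivableP (@C1_derivable _ _ _ v (smooth_C1 x sq)).
have Ds := derivableP (@C1_derivable _ _ _ v (smooth_C1 x ss)).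
have Dt := derivableP (@C1_derivable _ _ _ v (smooth_C1 x st)).
apply: (is_derive_eq (is_deriveD (is_deriveD (is_deriveD (is_deriveM Dp Dp)
  (is_deriveM Dq Dq)) (is_deriveM Ds Ds)) (is_deriveM Dt Dt))).
rewrite /GRing.scale /=.
move: ('D_v p x) ('D_v q x) ('D_v s x) ('D_v t x) (p x) (q x) (s x) (t x).
by move=> *; ring.
Qed.

Lemma C1_field1 x : 0 < x.2 -> C1 (field1 p q s t) x.
Proof. by move=> x0; exact: (C1D (C1_flux1 sp sq ss st x) (C1M (C1_dens x) (C1_slope1 x0))). Qed.
Lemma C1_field2 x : 0 < x.2 -> C1 (field2 p q s t) x.
Proof. by move=> x0; exact: (C1D (C1_flux2 sp sq ss st x) (C1M (C1_dens x) (C1_slope2 x0))). Qed.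
Lemma C1_field3 x : 0 < x.2 -> C1 (field3 p q s t) x.
Proof. by move=> x0; exact: (C1D (C1_flux3 sp sq ss st x) (C1M (C1_dens x) (C1_slope3 x0))). Qed.

Lemma hardy_half x (C k : R) : 0 < x.2 -> 0 <= C < 1 ->
  b = C / (2 * (1 - C)) -> C * erad x <= x.2 ->
  k <= (1 + 2 * C) / (4 * (1 - C ^+ 2)) ->
  k * (erad x)^-1 ^+ 2 * dens p q s t x <= weyl_sqr p q s t x -
    ('D_e1 (field1 p q s t) x + 'D_e2 (field2 p q s t) x + 'D_e3 (field3 p q s t) x).
Proof.
move=> x0 C01 bE xC kC; have H := slope_riccati x0 C01 bE xC kC.
have DS f v (Cf : C1 f x) := derivableP (@C1_derivable _ _ _ v Cf).
have [_ ->] := is_deriveD (DS _ e1 (C1_flux1 sp sq ss st x))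
  (is_deriveM (is_derive_dens x e1) (DS _ e1 (C1_slope1 x0))).
have [_ ->] := is_deriveD (DS _ e2 (C1_flux2 sp sq ss st x))
  (is_deriveM (is_derive_dens x e2) (DS _ e2 (C1_slope2 x0))).
have [_ ->] := is_deriveD (DS _ e3 (C1_flux3 sp sq ss st x))
  (is_deriveM (is_derive_dens x e3) (DS _ e3 (C1_slope3 x0))).
have F := divergence_flux sp sq ss st x.
move: F H; rewrite /GRing.scale /= /dens /grad_sqr.
move: ('D_e1 (flux1 _ _ _ _) x) ('D_e2 (flux2 _ _ _ _) x) => F1 F2.
move: ('D_e3 (flux3 _ _ _ _) x) (weyl_sqr _ _ _ _ x) => F3 W.
move: ('D_e1 slope1 x) ('D_e2 slope2 x) ('D_e3 slope3 x) => X11 X22 X33.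
move: (slope1 x) (slope2 x) (slope3 x) (k * _) => X1 X2 X3 K.
move: ('D_e1 p x) ('D_e2 p x) ('D_e3 p x) => p1 p2 p3.
move: ('D_e1 q x) ('D_e2 q x) ('D_e3 q x) => q1 q2 q3.
move: ('D_e1 s x) ('D_e2 s x) ('D_e3 s x) => s1 s2 s3.
move: ('D_e1 t x) ('D_e2 t x) ('D_e3 t x) => t1 t2 t3.
move: (p x) (q x) (s x) (t x) => p0 q0 s0 t0 F H.
have Hp := hardy_component p0 p1 p2 p3 H.
have Hq := hardy_component q0 q1 q2 q3 H.
have Hs := hardy_component s0 s1 s2 s3 H.
have Ht := hardy_component t0 t1 t2 t3 H.
have -> : K * (p0 * p0 + q0 * q0 + s0 * s0 + t0 * t0) =
  K * p0 ^+ 2 + K * q0 ^+ 2 + K * s0 ^+ 2 + K * t0 ^+ 2 by ring.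
apply: (le_trans (lerD (lerD (lerD Hp Hq) Hs) Ht)).
rewrite -subr_ge0; move: F.
set G := (X in _ = W - X -> _) => F.
rewrite (_ : _ - _ = W - (F1 + F2 + F3) - G); last by rewrite /G; ring.
by rewrite F subKr subrr.
Qed.

End Half.

End Hardy.

(** * The corrected flux is tangential *)

Section BoundaryFlux.
Context {R : realType}.

Section Isig.
Variables (n1 n2 p q s t : R -> R) (n3 x : R).
Variables (n1' n2' p' q' s' t' : R).
Hypotheses (D1 : is_derive x (1 : R) n1 n1') (D2 : is_derive x (1 : R) n2 n2').
Hypotheses (Dp : is_derive x (1 : R) p p') (Dq : is_derive x (1 : R) q q').
Hypotheses (Ds : is_derive x (1 : R) s s') (Dt : is_derive x (1 : R) t t').

Lemma derive_isig1 (F : R -> R) (F' : R) : is_derive x (1 : R) F F' ->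
  (\forall y \near x, F y = isig1 (n1 y) (n2 y) n3 (p y) (q y) (s y) (t y)) ->
  F' = isig1 (n1 x) (n2 x) n3 p' q' s' t'
     + isig1 n1' n2' 0 (p x) (q x) (s x) (t x).
Proof.
move=> [dF <-] /near_eq_derive ->.
have D := is_deriveN (is_deriveB (is_deriveD (is_deriveZ n3 Dq)
  (is_deriveM D1 Dt)) (is_deriveM D2 Ds)).
rewrite (@derive_val _ _ _ _ _ _ _ D) /isig1 /GRing.scale /=; ring.
Qed.

Lemma derive_isig2 (F : R -> R) (F' : R) : is_derive x (1 : R) F F' ->
  (\forall y \near x, F y = isig2 (n1 y) (n2 y) n3 (p y) (q y) (s y) (t y)) ->
  F' = isig2 (n1 x) (n2 x) n3 p' q' s' t'
     + isig2 n1' n2' 0 (p x) (q x) (s x) (t x).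
Proof.
move=> [dF <-] /near_eq_derive ->.
have D := is_deriveD (is_deriveD (is_deriveZ n3 Dp)
  (is_deriveM D1 Ds)) (is_deriveM D2 Dt).
rewrite (@derive_val _ _ _ _ _ _ _ D) /isig2 /GRing.scale /=; ring.
Qed.

Lemma derive_isig3 (F : R -> R) (F' : R) : is_derive x (1 : R) F F' ->
  (\forall y \near x, F y = isig3 (n1 y) (n2 y) n3 (p y) (q y) (s y) (t y)) ->
  F' = isig3 (n1 x) (n2 x) n3 p' q' s' t'
     + isig3 n1' n2' 0 (p x) (q x) (s x) (t x).
Proof.
move=> [dF <-] /near_eq_derive ->.
have D := is_deriveN (is_deriveB (is_deriveD (is_deriveM D1 Dq)
  (is_deriveM D2 Dp)) (is_deriveZ n3 Dt)).
rewrite (@derive_val _ _ _ _ _ _ _ D) /isig3 /GRing.scale /=; ring.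
Qed.

Lemma derive_isig4 (F : R -> R) (F' : R) : is_derive x (1 : R) F F' ->
  (\forall y \near x, F y = isig4 (n1 y) (n2 y) n3 (p y) (q y) (s y) (t y)) ->
  F' = isig4 (n1 x) (n2 x) n3 p' q' s' t'
     + isig4 n1' n2' 0 (p x) (q x) (s x) (t x).
Proof.
move=> [dF <-] /near_eq_derive ->.
have D := is_deriveB (is_deriveB (is_deriveM D1 Dp)
  (is_deriveM D2 Dq)) (is_deriveZ n3 Ds).
rewrite (@derive_val _ _ _ _ _ _ _ D) /isig4 /GRing.scale /=; ring.
Qed.

End Isig.

Variables (C S b : R).
Hypotheses (C0 : 0 < C) (S0 : 0 < S) (CS : C ^+ 2 + S ^+ 2 = 1).
Hypothesis bE : b = C / (2 * (1 - C)).
Let m := C / S.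

Definition tang1 (f : R3 R -> R) x : R :=
  'D_e1 f (shear m x) + m * (x.1.1 / rho x) * 'D_e3 f (shear m x).
Definition tang2 (f : R3 R -> R) x : R :=
  'D_e2 f (shear m x) + m * (x.1.2 / rho x) * 'D_e3 f (shear m x).

Lemma is_derive_tang1 (f : R3 R -> R) (x y : R) : 0 < rho (x, y, 0) -> smooth f ->
  is_derive x (1 : R) (fun t => f (shear m (t, y, 0))) (tang1 f (x, y, 0)).
Proof.
move=> r0 sf; have df := C1_differentiable (smooth_C1 (shear m (x, y, 0)) sf).
have := is_derive_curve (c := fun t => shear m (t, y, 0)) df
  (is_derive_id _ _) (is_derive_cst _ _ _) (is_derive_height m 0 (is_derive_rho1 r0)).
by rewrite derive_partials//= mul0r addr0 mul1r.
Qed.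

Lemma is_derive_tang2 (f : R3 R -> R) (x y : R) : 0 < rho (x, y, 0) -> smooth f ->
  is_derive y (1 : R) (fun t => f (shear m (x, t, 0))) (tang2 f (x, y, 0)).
Proof.
move=> r0 sf; have df := C1_differentiable (smooth_C1 (shear m (x, y, 0)) sf).
have := is_derive_curve (c := fun t => shear m (x, t, 0)) df
  (is_derive_cst _ _ _) (is_derive_id _ _) (is_derive_height m 0 (is_derive_rho2 r0)).
by rewrite derive_partials//= mul0r add0r mul1r.
Qed.

(** The horizontal unit vector [(c1, c2)] turns at the rates [c2 / rho] and
    [- c1 / rho], which is where the curvature [k] of the cone enters. *)
Lemma is_derive_cosines1 (x y : R) : 0 < rho (x, y, 0) ->
  let c1 := x / rho (x, y, 0) in let c2 := y / rho (x, y, 0) in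
  let k := C / rho (x, y, 0) in
  is_derive x (1 : R) (fun t => C * (t / rho (t, y, 0))) (k * c2 * c2) /\
  is_derive x (1 : R) (fun t => C * (y / rho (t, y, 0))) (- (k * c2 * c1)).
Proof.
move=> r0 c1 c2 k; have r0' : rho (x, y, 0) != 0 by rewrite gt_eqF.
have D := @is_deriveV _ (fun t => rho (t, y, 0)) _ _ _ r0' (is_derive_rho1 r0).
have E : rho (x, y, 0) ^+ 2 = x ^+ 2 + y ^+ 2.
  by rewrite /rho sqr_sqrtr// addr_ge0 ?sqr_ge0.
split.
  apply: (is_derive_eq (is_deriveZ C (is_deriveM (is_derive_id _ _) D))).
  rewrite /c1 /c2 /k /GRing.scale /=; move: E r0'; move: (rho _) => r E r0'.
  apply/eqP; rewrite -subr_eq0; apply/eqP.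
  transitivity (C * r^-1 ^+ 3 * (r ^+ 2 - (x ^+ 2 + y ^+ 2))); first by field.
  by rewrite E subrr mulr0.
apply: (is_derive_eq (is_deriveZ C (is_deriveZ y D))).
by rewrite /c1 /c2 /k /GRing.scale /=; field.
Qed.

Lemma is_derive_cosines2 (x y : R) : 0 < rho (x, y, 0) ->
  let c1 := x / rho (x, y, 0) in let c2 := y / rho (x, y, 0) in
  let k := C / rho (x, y, 0) in
  is_derive y (1 : R) (fun t => C * (x / rho (x, t, 0))) (- (k * c1) * c2) /\
  is_derive y (1 : R) (fun t => C * (t / rho (x, t, 0))) (- (- (k * c1) * c1)).
Proof.
move=> r0 c1 c2 k.
have r0' : 0 < rho (y, x, 0) by rewrite rho_swap.
have [D1 D2] := is_derive_cosines1 r0'; rewrite (rho_swap x y) in D1 D2.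
have q1 : (fun t => C * (x / rho (x, t, 0))) = (fun t => C * (x / rho (t, x, 0))).
  by apply/funext => t; rewrite rho_swap.
have q2 : (fun t => C * (t / rho (x, t, 0))) = (fun t => C * (t / rho (t, x, 0))).
  by apply/funext => t; rewrite rho_swap.
by rewrite q1 q2; split; [apply: is_derive_eq D2 _|apply: is_derive_eq D1 _];
  rewrite ?mulNr ?opprK.
Qed.

(** The normal derivatives cancel in the flux because [W] is antisymmetric: only
    the combinations [n_j d_k - n_k d_j] occur. *)
Lemma normal_flux (p q s t : R3 R -> R) x :
  let c1 := x.1.1 / rho x in let c2 := x.1.2 / rho x in let z := shear m x in
  C * c1 * flux1 p q s t z + C * c2 * flux2 p q s t z - S * flux3 p q s t z =
  nflux (C * c1) (C * c2) (- S) (p z) (q z) (s z) (t z)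
    (tang1 p x) (tang1 q x) (tang1 s x) (tang1 t x)
    (tang2 p x) (tang2 q x) (tang2 s x) (tang2 t x).
Proof.
have mS : C = m * S by rewrite /m divfK// gt_eqF.
move=> c1 c2 z; rewrite /tang1 /tang2 -/c1 -/c2 -/z /flux1 /flux2 /flux3 /bracket.
rewrite /nflux /wr mS; move: m => m'.
move: ('D_e1 p z) ('D_e2 p z) ('D_e3 p z) ('D_e1 q z) ('D_e2 q z) ('D_e3 q z).
move: ('D_e1 s z) ('D_e2 s z) ('D_e3 s z) ('D_e1 t z) ('D_e2 t z) ('D_e3 t z).
by move: (p z) (q z) (s z) (t z) c1 c2 => *; ring.
Qed.

(** The condition that determines [b]. *)
Lemma normal_slope x : x.2 = 0 -> 0 < rho x ->
  let c1 := x.1.1 / rho x in let c2 := x.1.2 / rho x in let z := shear m x in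
  C * c1 * slope1 b z + C * c2 * slope2 b z - S * slope3 b z =
  - (C / rho x) / 2.
Proof.
move=> x0 r0 c1 c2 z.
have C1 : C < 1.
  have : C ^+ 2 < 1 by rewrite -CS ltrDl exprn_gt0.
  by rewrite -[X in _ < X](expr1n _ 2) ltr_pXn2r ?nnegrE// ltW.
have z1 : z.1.1 = rho x * c1 by rewrite /c1 mulrC divfK// gt_eqF.
have z2 : z.1.2 = rho x * c2 by rewrite /c2 mulrC divfK// gt_eqF.
have z3 : z.2 = rho x * C / S by rewrite /z /= x0 addr0 /m; ring.
have E : c1 ^+ 2 + c2 ^+ 2 = 1.
  rewrite /c1 /c2 !expr_div_n -mulrDl /rho sqr_sqrtr ?addr_ge0 ?sqr_ge0//.
  by rewrite divff// gt_eqF// -sqrtr_gt0.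
clearbody c1 c2.
have eradz : erad z = rho x / S.
  rewrite /erad z1 z2 z3 (_ : _ + _ = (rho x / S) ^+ 2).
    by rewrite sqrtr_sqr gtr0_norm// divr_gt0.
  have -> : (rho x * c1) ^+ 2 + (rho x * c2) ^+ 2 = rho x ^+ 2.
    by rewrite !exprMn -mulrDr E mulr1.
  have -> : rho x ^+ 2 = (rho x / S) ^+ 2 * S ^+ 2 by field; rewrite gt_eqF.
  rewrite (_ : rho x * C / S = rho x / S * C); last by ring.
  by rewrite [(_ * C) ^+ 2]exprMn -mulrDr [S ^+ 2 + _]addrC CS mulr1.
have S0' : S != 0 by rewrite gt_eqF.
have r0' : rho x != 0 by rewrite gt_eqF.
have Cm : 1 - C != 0 by rewrite gt_eqF// subr_gt0.
have Cp : 1 + C != 0 by rewrite gt_eqF// addr_gt0.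
have i1 : (erad z)^-1 = S / rho x by rewrite eradz invf_div.
have i2 : (erad z + z.2)^-1 = S / (rho x * (1 + C)).
  have -> : erad z + z.2 = rho x * (1 + C) / S by rewrite eradz z3; ring.
  by rewrite invf_div.
rewrite /slope1 /slope2 /slope3 /slopeQ i1 i2 z1 z2 z3 bE.
clear - r0' S0' Cm Cp E CS.
move: r0' E; move: (rho x) => r r0' E.
apply/eqP; rewrite -subr_eq0; apply/eqP.
transitivity (C * r * (- (2^-1 + C / (2 * (1 - C))) * (S / r * (S / r))
    + C / (2 * (1 - C)) * (S / r * (S / (r * (1 + C))))) * (c1 ^+ 2 + c2 ^+ 2 - 1)
  - C / (2 * (1 - C)) / ((1 + C) * r) * (C ^+ 2 + S ^+ 2 - 1)).
  by field; rewrite S0' r0' Cm Cp.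
by rewrite E CS !subrr !mulr0 subrr.
Qed.

Lemma and4p1 (A1 A2 A3 A4 : Prop) : [/\ A1, A2, A3 & A4] -> A1. Proof. by case. Qed.
Lemma and4p2 (A1 A2 A3 A4 : Prop) : [/\ A1, A2, A3 & A4] -> A2. Proof. by case. Qed.
Lemma and4p3 (A1 A2 A3 A4 : Prop) : [/\ A1, A2, A3 & A4] -> A3. Proof. by case. Qed.
Lemma and4p4 (A1 A2 A3 A4 : Prop) : [/\ A1, A2, A3 & A4] -> A4. Proof. by case. Qed.

Section BagSpinors.
Variables (p q s t P Q S' T : R3 R -> R).
Hypotheses (sp : smooth p) (sq : smooth q) (ss : smooth s) (st : smooth t).
Hypotheses (sP : smooth P) (sQ : smooth Q) (sS : smooth S') (sT : smooth T).

Definition bag_at (y : R3 R) :=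
  let n1 := C * (y.1.1 / rho y) in let n2 := C * (y.1.2 / rho y) in
  let z := shear m y in
  [/\ P z = isig1 n1 n2 (- S) (p z) (q z) (s z) (t z),
      Q z = isig2 n1 n2 (- S) (p z) (q z) (s z) (t z),
      S' z = isig3 n1 n2 (- S) (p z) (q z) (s z) (t z) &
      T z = isig4 n1 n2 (- S) (p z) (q z) (s z) (t z)].
Hypothesis bag : forall y, y.1.2 != 0 -> y.2 = 0 -> bag_at y.

(** Differentiating the boundary condition along the boundary expresses the
    tangential derivatives of the lower spinor through those of the upper one, up
    to a term where the normal is differentiated. By [nflux_isig] the fluxes of
    the two spinors cancel except for that term, which [nflux_curvature] computes
    and [normal_slope] compensates. *)
Lemma bag_tangential x : x.1.2 != 0 -> x.2 = 0 ->
  let z := shear m x in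
  field3 b p q s t z + field3 b P Q S' T z =
    m * (x.1.1 / rho x) * (field1 b p q s t z + field1 b P Q S' T z)
  + m * (x.1.2 / rho x) * (field2 b p q s t z + field2 b P Q S' T z).
Proof.
case: x => -[x y] h /= y0 ->.
set z := shear m (x, y, 0).
have r0 : 0 < rho (x, y, 0) by rewrite rho_gt0// y0 orbT.
have [A1 A2] := is_derive_cosines1 r0; have [B1 B2] := is_derive_cosines2 r0.
have T1 f (sf : smooth f) := is_derive_tang1 r0 sf.
have T2 f (sf : smooth f) := is_derive_tang2 r0 sf.
have nb (k : R -> R -> Prop) : (forall a c, c != 0 -> k a c) ->
    (\forall a \near x, k a y) /\ (\forall c \near y, k x c).
  move=> H; split; first by near=> a; exact: H.
  near=> c; apply: H; near: c.
  have ci : {for y, continuous (fun c : R => c)} by exact: cvg_id.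
  exact: (cvgr_neq0 _ ci y0).
have bag' a c : c != 0 -> bag_at (a, c, 0) by move=> c0; exact: bag.
have [N1 N2] := nb _ bag'.
pose l1 (f : R3 R -> R) (a : R) := f (shear m (a, y, 0)).
pose l2 (f : R3 R -> R) (c : R) := f (shear m (x, c, 0)).
pose u1 (a : R) := C * (a / rho (a, y, 0)).
pose u2 (a : R) := C * (y / rho (a, y, 0)).
pose w1 (c : R) := C * (x / rho (x, c, 0)).
pose w2 (c : R) := C * (c / rho (x, c, 0)).
have dP1 : _ = _ := @derive_isig1 u1 u2 (l1 p) (l1 q) (l1 s) (l1 t) (- S) x
  _ _ (tang1 p (x, y, 0)) _ _ _ A1 A2 (T1 _ sq) (T1 _ ss) (T1 _ st)
  (l1 P) _ (T1 _ sP) (@filterS _ _ (nbhs_filter x) _ _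
    (fun a (h : bag_at (a, y, 0)) => and4p1 h) N1).
have dQ1 : _ = _ := @derive_isig2 u1 u2 (l1 p) (l1 q) (l1 s) (l1 t) (- S) x
  _ _ _ (tang1 q (x, y, 0)) _ _ A1 A2 (T1 _ sp) (T1 _ ss) (T1 _ st)
  (l1 Q) _ (T1 _ sQ) (@filterS _ _ (nbhs_filter x) _ _
    (fun a (h : bag_at (a, y, 0)) => and4p2 h) N1).
have dS1 : _ = _ := @derive_isig3 u1 u2 (l1 p) (l1 q) (l1 s) (l1 t) (- S) x
  _ _ _ _ (tang1 s (x, y, 0)) _ A1 A2 (T1 _ sp) (T1 _ sq) (T1 _ st)
  (l1 S') _ (T1 _ sS) (@filterS _ _ (nbhs_filter x) _ _
    (fun a (h : bag_at (a, y, 0)) => and4p3 h) N1).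
have dT1 : _ = _ := @derive_isig4 u1 u2 (l1 p) (l1 q) (l1 s) (l1 t) (- S) x
  _ _ _ _ _ (tang1 t (x, y, 0)) A1 A2 (T1 _ sp) (T1 _ sq) (T1 _ ss)
  (l1 T) _ (T1 _ sT) (@filterS _ _ (nbhs_filter x) _ _
    (fun a (h : bag_at (a, y, 0)) => and4p4 h) N1).
have dP2 : _ = _ := @derive_isig1 w1 w2 (l2 p) (l2 q) (l2 s) (l2 t) (- S) y
  _ _ (tang2 p (x, y, 0)) _ _ _ B1 B2 (T2 _ sq) (T2 _ ss) (T2 _ st)
  (l2 P) _ (T2 _ sP) (@filterS _ _ (nbhs_filter y) _ _
    (fun a (h : bag_at (x, a, 0)) => and4p1 h) N2).
have dQ2 : _ = _ := @derive_isig2 w1 w2 (l2 p) (l2 q) (l2 s) (l2 t) (- S) y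
  _ _ _ (tang2 q (x, y, 0)) _ _ B1 B2 (T2 _ sp) (T2 _ ss) (T2 _ st)
  (l2 Q) _ (T2 _ sQ) (@filterS _ _ (nbhs_filter y) _ _
    (fun a (h : bag_at (x, a, 0)) => and4p2 h) N2).
have dS2 : _ = _ := @derive_isig3 w1 w2 (l2 p) (l2 q) (l2 s) (l2 t) (- S) y
  _ _ _ _ (tang2 s (x, y, 0)) _ B1 B2 (T2 _ sp) (T2 _ sq) (T2 _ st)
  (l2 S') _ (T2 _ sS) (@filterS _ _ (nbhs_filter y) _ _
    (fun a (h : bag_at (x, a, 0)) => and4p3 h) N2).
have dT2 : _ = _ := @derive_isig4 w1 w2 (l2 p) (l2 q) (l2 s) (l2 t) (- S) y
  _ _ _ _ _ (tang2 t (x, y, 0)) B1 B2 (T2 _ sp) (T2 _ sq) (T2 _ ss)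
  (l2 T) _ (T2 _ sT) (@filterS _ _ (nbhs_filter y) _ _
    (fun a (h : bag_at (x, a, 0)) => and4p4 h) N2).
have [bP bQ bS bT] := bag' x y y0.
have F := normal_flux p q s t (x, y, 0); have G := normal_flux P Q S' T (x, y, 0).
have X := normal_slope (x := (x, y, 0)) erefl r0.
have E : (x / rho (x, y, 0)) ^+ 2 + (y / rho (x, y, 0)) ^+ 2 = 1.
  rewrite !expr_div_n -mulrDl /rho sqr_sqrtr ?addr_ge0 ?sqr_ge0//=.
  by rewrite divff// gt_eqF// -sqrtr_gt0.
move: F G X => /=; rewrite -/z dP1 dQ1 dS1 dT1 dP2 dQ2 dS2 dT2.
clear dP1 dQ1 dS1 dT1 dP2 dQ2 dS2 dT2; rewrite {}/l1 {}/l2 {}/u1 {}/u2 {}/w1 {}/w2 -/z.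
move: (tang1 p _) (tang1 q _) (tang1 s _) (tang1 t _) => p1 q1 s1 t1.
move: (tang2 p _) (tang2 q _) (tang2 s _) (tang2 t _) => p2 q2 s2 t2.
move: bP bQ bS bT => /=; rewrite -/z => bP bQ bS bT.
rewrite nfluxD bP bQ bS bT nflux_isig nflux_curvature.
have nn : (C * (x / rho (x, y, 0))) ^+ 2 + (C * (y / rho (x, y, 0))) ^+ 2
    + (- S) ^+ 2 = 1.
  by rewrite !(@exprMn _ 2 C) -mulrDr E mulr1 sqrrN CS.
have dE : dens P Q S' T z = dens p q s t z.
  by rewrite /dens bP bQ bS bT -!expr2 isig_sqr.
rewrite nn E !mulr1 [S ^+ 2 + _]addrC CS mulr1.
have d0 : p z ^+ 2 + q z ^+ 2 + s z ^+ 2 + t z ^+ 2 = dens p q s t z.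
  by rewrite /dens !expr2.
rewrite d0 /field1 /field2 /field3 dE.
have -> : m = C / S by [].
have S0' : S != 0 by rewrite gt_eqF.
move: (nflux _ _ _ _ _ _ _ _ _ _ _ _ _ _ _) (dens _ _ _ _ _) => N D.
move: (flux1 p _ _ _ _) (flux2 p _ _ _ _) (flux3 p _ _ _ _) => F1 F2 F3.
move: (flux1 P _ _ _ _) (flux2 P _ _ _ _) (flux3 P _ _ _ _) => G1 G2 G3.
move: (slope1 _ _) (slope2 _ _) (slope3 _ _) (x / _) (y / _) (C / rho _).
move=> X1 X2 X3 c1 c2 k F G X.
apply: (mulfI S0'); apply/eqP; rewrite -subr_eq0; apply/eqP.
transitivity (- ((C * c1 * F1 + C * c2 * F2 - S * F3)
  + (C * c1 * G1 + C * c2 * G2 - S * G3)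
  + 2 * D * (C * c1 * X1 + C * c2 * X2 - S * X3))); first by field.
by rewrite F G X; field.
Unshelve. all: by end_near. Qed.

End BagSpinors.
End BoundaryFlux.

(** * Components of the Dirac operator *)

Section DiracEntries.
Context {R : realType}.
Implicit Types (x : R3 R) (U : R3 R -> C4 R).

Let l0 : (0 : 'I_2) = lshift 1 (0 : 'I_1). Proof. exact: val_inj. Qed.
Let r0 : (1 : 'I_2) = rshift 1 (0 : 'I_1). Proof. exact: val_inj. Qed.

Lemma mx2E00 (a b c d : R[i]) : mx2 a b c d 0 0 = a.
Proof. by rewrite l0 /mx2 (@block_mxEul _ 1 1 1 1) mxE eqxx. Qed.
Lemma mx2E01 (a b c d : R[i]) : mx2 a b c d 0 1 = b.
Proof. by rewrite l0 r0 /mx2 (@block_mxEur _ 1 1 1 1) mxE eqxx. Qed.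
Lemma mx2E10 (a b c d : R[i]) : mx2 a b c d 1 0 = c.
Proof. by rewrite l0 r0 /mx2 (@block_mxEdl _ 1 1 1 1) mxE eqxx. Qed.
Lemma mx2E11 (a b c d : R[i]) : mx2 a b c d 1 1 = d.
Proof. by rewrite r0 /mx2 (@block_mxEdr _ 1 1 1 1) mxE eqxx. Qed.
Definition mx2E := (mx2E00, mx2E01, mx2E10, mx2E11).

Definition up0 : 'I_(2 + 2) := lshift 2 0.
Definition up1 : 'I_(2 + 2) := lshift 2 1.
Definition dn0 : 'I_(2 + 2) := rshift 2 0.
Definition dn1 : 'I_(2 + 2) := rshift 2 1.

Lemma sum_spinor (V : nmodType) (F : 'I_(2 + 2) -> V) :
  \sum_k F k = F up0 + F up1 + (F dn0 + F dn1).
Proof.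
rewrite big_split_ord /= !big_ord_recl !big_ord0 !addr0.
by congr (F _ + F _ + (F _ + F _)); apply: val_inj.
Qed.

Lemma alpha_mulE j (v : C4 R) :
  [/\ (alpha_mx j *m v) up0 0 = sigma_mx j 0 0 * v dn0 0 + sigma_mx j 0 1 * v dn1 0,
      (alpha_mx j *m v) up1 0 = sigma_mx j 1 0 * v dn0 0 + sigma_mx j 1 1 * v dn1 0,
      (alpha_mx j *m v) dn0 0 = sigma_mx j 0 0 * v up0 0 + sigma_mx j 0 1 * v up1 0 &
      (alpha_mx j *m v) dn1 0 = sigma_mx j 1 0 * v up0 0 + sigma_mx j 1 1 * v up1 0].
Proof.
by split; rewrite mxE sum_spinor /alpha_mx /up0 /up1 /dn0 /dn1
  ?block_mxEul ?block_mxEur ?block_mxEdl ?block_mxEdr !mxE !mul0r ?addr0 ?add0r.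
Qed.

Lemma sum3 (V : nmodType) (F : 'I_3 -> V) :
  \sum_(j < 3) F j = F (inord 0) + F (inord 1) + F (inord 2).
Proof.
rewrite !big_ord_recl big_ord0 addr0 addrA; congr (F _ + F _ + F _);
  by apply: val_inj; rewrite /= inordK.
Qed.

Lemma sigma0E : sigma_mx (inord 0) = sigma1 :> 'M[R[i]]_2.
Proof. by rewrite /sigma_mx inordK. Qed.
Lemma sigma1E : sigma_mx (inord 1) = sigma2 :> 'M[R[i]]_2.
Proof. by rewrite /sigma_mx inordK. Qed.
Lemma sigma2E : sigma_mx (inord 2) = sigma3 :> 'M[R[i]]_2.
Proof. by rewrite /sigma_mx inordK. Qed.

Definition re k U x : R := complex.Re (U x k 0).
Definition im k U x : R := complex.Im (U x k 0).

Lemma cnormE (v : C4 R) : cnorm v ^+ 2 =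
  \sum_k (complex.Re (v k 0) ^+ 2 + complex.Im (v k 0) ^+ 2).
Proof.
rewrite /cnorm sqr_sqrtr// sumr_ge0// => k _.
by rewrite addr_ge0 ?sqr_ge0.
Qed.

Lemma cnorm_dens U x : cnorm (U x) ^+ 2 =
  dens (re up0 U) (im up0 U) (re up1 U) (im up1 U) x
  + dens (re dn0 U) (im dn0 U) (re dn1 U) (im dn1 U) x.
Proof. by rewrite cnormE sum_spinor /dens /re /im !expr2 !addrA. Qed.

Lemma enormE x : enorm x = erad x.
Proof.
by rewrite /enorm /erad sum3 /coord3 !inordK.
Qed.

Lemma weyl_entries (v1 v2 v3 : C4 R) :
  let w := - 'i%C *: (alpha_mx (inord 0) *m v1 + alpha_mx (inord 1) *m v2
                      + alpha_mx (inord 2) *m v3) in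
  [/\ w up0 0 = - 'i%C * (v1 dn1 0 - 'i%C * v2 dn1 0 + v3 dn0 0),
      w up1 0 = - 'i%C * (v1 dn0 0 + 'i%C * v2 dn0 0 - v3 dn1 0),
      w dn0 0 = - 'i%C * (v1 up1 0 - 'i%C * v2 up1 0 + v3 up0 0) &
      w dn1 0 = - 'i%C * (v1 up0 0 + 'i%C * v2 up0 0 - v3 up1 0)].
Proof.
move=> w; have wE k : w k 0 = - 'i%C * ((alpha_mx (inord 0) *m v1) k 0
    + (alpha_mx (inord 1) *m v2) k 0 + (alpha_mx (inord 2) *m v3) k 0).
  by rewrite /w; move: (alpha_mx _ *m v1) (alpha_mx _ *m v2) (alpha_mx _ *m v3)
    => a b c; rewrite !mxE.
have [A1 B1 C1 D1] := alpha_mulE (inord 0) v1.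
have [A2 B2 C2 D2] := alpha_mulE (inord 1) v2.
have [A3 B3 C3 D3] := alpha_mulE (inord 2) v3.
split; rewrite wE ?A1 ?A2 ?A3 ?B1 ?B2 ?B3 ?C1 ?C2 ?C3 ?D1 ?D2 ?D3;
  rewrite sigma0E sigma1E sigma2E /sigma1 /sigma2 /sigma3 !mx2E;
  by rewrite !mul0r ?add0r ?addr0 !mul1r ?mulN1r ?mulNr.
Qed.

Lemma weyl_norm (v1 v2 v3 : C4 R) (a1 b1 a2 b2 a3 b3 : 'I_(2 + 2) -> R) :
  (forall k, v1 k 0 = (a1 k +i* b1 k)%C) ->
  (forall k, v2 k 0 = (a2 k +i* b2 k)%C) ->
  (forall k, v3 k 0 = (a3 k +i* b3 k)%C) ->
  cnorm (- 'i%C *: (alpha_mx (inord 0) *m v1 + alpha_mx (inord 1) *m v2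
                      + alpha_mx (inord 2) *m v3)) ^+ 2 =
  ((a3 up0 + a1 up1 + b2 up1) ^+ 2 + (b3 up0 + b1 up1 - a2 up1) ^+ 2
    + (a1 up0 - b2 up0 - a3 up1) ^+ 2 + (b1 up0 + a2 up0 - b3 up1) ^+ 2)
  + ((a3 dn0 + a1 dn1 + b2 dn1) ^+ 2 + (b3 dn0 + b1 dn1 - a2 dn1) ^+ 2
    + (a1 dn0 - b2 dn0 - a3 dn1) ^+ 2 + (b1 dn0 + a2 dn0 - b3 dn1) ^+ 2).
Proof.
move=> E1 E2 E3; rewrite cnormE sum_spinor.
have [-> -> -> ->] := weyl_entries v1 v2 v3.
rewrite !E1 !E2 !E3 {E1 E2 E3}; simpc => /=; ring.
Qed.

Lemma cnorm_dirac U x : cnorm (dirac_op U x) ^+ 2 =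
  weyl_sqr (re up0 U) (im up0 U) (re up1 U) (im up1 U) x
  + weyl_sqr (re dn0 U) (im dn0 U) (re dn1 U) (im dn1 U) x.
Proof.
rewrite /dirac_op sum3.
have P1 k : partialC4 (inord 0) U x k 0 = ('D_e1 (re k U) x +i* 'D_e1 (im k U) x)%C.
  by rewrite mxE basis3_e1.
have P2 k : partialC4 (inord 1) U x k 0 = ('D_e2 (re k U) x +i* 'D_e2 (im k U) x)%C.
  by rewrite mxE basis3_e2.
have P3 k : partialC4 (inord 2) U x k 0 = ('D_e3 (re k U) x +i* 'D_e3 (im k U) x)%C.
  by rewrite mxE basis3_e3.
by rewrite (weyl_norm P1 P2 P3).
Qed.

End DiracEntries.

(** * Components of the boundary condition *)

Section BagEntries.
Context {R : realType}.
Implicit Types (x : R3 R) (U : R3 R -> C4 R).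

Lemma beta_mulE (v : C4 R) :
  (beta_mx *m v) dn0 0 = - v dn0 0 /\ (beta_mx *m v) dn1 0 = - v dn1 0.
Proof.
split; rewrite mxE sum_spinor /beta_mx /up0 /up1 /dn0 /dn1
  ?block_mxEdl ?block_mxEdr !mxE /= ?mulr0n ?mulr1n ?oppr0 !mul0r ?add0r ?addr0.
  by rewrite mulN1r.
by rewrite mulN1r.
Qed.

Lemma alpha_dot_mulE (b : R3 R) (v : C4 R) :
  (alpha_dot b *m v) dn0 0 = b.1.1%:C%C * v up1 0 - b.1.2%:C%C * ('i%C * v up1 0)
     + b.2%:C%C * v up0 0 /\
  (alpha_dot b *m v) dn1 0 = b.1.1%:C%C * v up0 0 + b.1.2%:C%C * ('i%C * v up0 0)
     - b.2%:C%C * v up1 0.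
Proof.
have E k : (alpha_dot b *m v) k 0 = b.1.1%:C%C * (alpha_mx (inord 0) *m v) k 0
    + b.1.2%:C%C * (alpha_mx (inord 1) *m v) k 0
    + b.2%:C%C * (alpha_mx (inord 2) *m v) k 0.
  rewrite /alpha_dot sum3 !mulmxDl -!scalemxAl /coord3 !inordK//=.
  by move: (alpha_mx _ *m v) (alpha_mx _ *m v) (alpha_mx _ *m v) => a1 a2 a3;
    rewrite !mxE.
have [_ _ C1 D1] := alpha_mulE (inord 0) v.
have [_ _ C2 D2] := alpha_mulE (inord 1) v.
have [_ _ C3 D3] := alpha_mulE (inord 2) v.
split; rewrite E ?C1 ?C2 ?C3 ?D1 ?D2 ?D3;
  rewrite sigma0E sigma1E sigma2E /sigma1 /sigma2 /sigma3 !mx2E;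
  by rewrite !mul0r ?add0r ?addr0 !mul1r ?mulN1r ?mulNr ?mulrN.
Qed.

Lemma bag_entries (b : R3 R) (v : C4 R) (p q s t : R) :
  v up0 0 = (p +i* q)%C -> v up1 0 = (s +i* t)%C ->
  v + 'i%C *: (beta_mx *m alpha_dot b *m v) = 0 ->
  v dn0 0 = (isig1 b.1.1 b.1.2 b.2 p q s t +i* isig2 b.1.1 b.1.2 b.2 p q s t)%C /\
  v dn1 0 = (isig3 b.1.1 b.1.2 b.2 p q s t +i* isig4 b.1.1 b.1.2 b.2 p q s t)%C.
Proof.
move=> v0 v1 /matrixP bag; rewrite -mulmxA in bag.
have [B0 B1] := beta_mulE (alpha_dot b *m v).
have [A0 A1] := alpha_dot_mulE b v; rewrite v0 v1 in A0 A1.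
have E k : v k 0 = - ('i%C * (beta_mx *m (alpha_dot b *m v)) k 0).
  have := bag k 0; move: (beta_mx *m _) => w; rewrite !mxE => /eqP.
  by rewrite addr_eq0 => /eqP.
rewrite (E dn0) (E dn1) B0 B1 A0 A1.
split; simpc; rewrite /isig1 /isig2 /isig3 /isig4; congr (_ +i* _)%C; ring.
Qed.

Lemma polar (a b r : R) : 0 < r -> a ^+ 2 + b ^+ 2 = r ^+ 2 -> b != 0 ->
  exists2 phi, 0 <= phi < 2 * pi & cos phi = a / r /\ sin phi = b / r.
Proof.
move=> r0 E b0; have r0' : r != 0 by rewrite gt_eqF.
pose c := a / r; pose d := b / r.
have cd : c ^+ 2 + d ^+ 2 = 1.
  by rewrite /c /d !expr_div_n -mulrDl E divff// expf_neq0.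
have c1 : -1 <= c <= 1.
  rewrite -ler_norml -[leRHS](@normr1 R) -ler_sqr ?nnegrE// real_normK ?num_real//.
  by rewrite normr1 expr1n -cd lerDl sqr_ge0.
have sE : sin (acos c) = `|d|.
  by rewrite sin_acos// -cd addrAC subrr add0r sqrtr_sqr.
have ap : 0 <= acos c <= pi by rewrite acos_ge0//= acos_lepi.
case/andP: ap => ap0 ap1.
have [d0|d0] := leP 0 d.
  exists (acos c); last by rewrite acosK// sE ger0_norm.
  by rewrite ap0/= (le_lt_trans ap1)// mulr_natl mulr2n ltrDr pi_gt0.
exists (2 * pi - acos c).
  rewrite subr_ge0 (le_trans ap1) ?mulr_natl ?mulr2n ?lerDr ?pi_ge0//=.
  rewrite gtrBl lt_def ap0 andbT; apply/eqP => ac0.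
  by move: sE; rewrite ac0 sin0 => /esym/eqP; rewrite normr_eq0 lt_eqF.
have -> : 2 * pi - acos c = - acos c + pi *+ 2 by rewrite mulr_natl addrC.
rewrite cosD2pi sinD2pi cosN sinN acosK// sE ltr0_norm// opprK.
by [].
Qed.

Variables (omega : R) (U : R3 R -> C4 R).
Hypothesis homega : 0 < omega < pi / 2.

Lemma bag_condition_at : bag_condition omega U ->
  forall y, y.1.2 != 0 -> y.2 = 0 ->
  bag_at (cos omega) (sin omega)
    (re up0 U) (im up0 U) (re up1 U) (im up1 U)
    (re dn0 U) (im dn0 U) (re dn1 U) (im dn1 U) y.
Proof.
move=> bag [[a c] h] /= c0 ->.
have s0 : 0 < sin omega by rewrite sin_gt0_pihalf.
have r0 : 0 < rho (a, c, 0) by rewrite rho_gt0// c0 orbT.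
have rE : a ^+ 2 + c ^+ 2 = rho (a, c, 0) ^+ 2.
  by rewrite /rho sqr_sqrtr// addr_ge0 ?sqr_ge0.
have [phi phi2 [cp sp]] := polar r0 rE c0.
have rS : 0 < rho (a, c, 0) / sin omega by rewrite divr_gt0.
have := bag _ _ rS phi2; rewrite /cone_boundary_point /cone_normal cp sp.
have -> : (rho (a, c, 0) / sin omega * sin omega * (a / rho (a, c, 0)),
  rho (a, c, 0) / sin omega * sin omega * (c / rho (a, c, 0)),
  rho (a, c, 0) / sin omega * cos omega) = shear (cos omega / sin omega) (a, c, 0).
  rewrite /shear /=; congr (_, _, _).
  - by field; rewrite !gt_eqF.
  - by field; rewrite !gt_eqF.
  - by rewrite addr0; field; rewrite gt_eqF.
move=> /= E; rewrite /bag_at /=.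
have eta (z : R[i]) : z = (complex.Re z +i* complex.Im z)%C by case: z.
have [D0 D1] := bag_entries (eta _) (eta _) E.
by split; rewrite /re /im ?D0 ?D1.
Qed.

End BagEntries.

(** * The integral inequality *)

Section Assembly.
Context {R : realType}.
Variables (omega : R) (U : R3 R -> C4 R).
Hypothesis homega : 0 < omega < pi / 2.
Hypothesis tU : test_function U.
Hypothesis bag : bag_condition omega U.

Local Notation mR := (measurableTypeR R).
Local Notation C := (cos omega).
Local Notation S := (sin omega).
Let m := C / S.
Let b := C / (2 * (1 - C)).

Let s0 : 0 < S. Proof. by rewrite sin_gt0_pihalf. Qed.
Let c0 : 0 < C.
Proof.
case/andP: homega => o0 o1; rewrite cos_gt0_pihalf// o1 andbT.
by rewrite (lt_trans _ o0)// oppr_lt0 divr_gt0// pi_gt0.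
Qed.
Let m0 : 0 < m. Proof. by rewrite divr_gt0. Qed.
Let c1 : C < 1.
Proof.
have : C ^+ 2 < 1 by rewrite -(cos2Dsin2 omega) ltrDl exprn_gt0.
by rewrite -[X in _ < X](expr1n _ 2) ltr_pXn2r ?nnegrE// ltW.
Qed.

Let smR k : smooth (re k U). Proof. by case: tU => /(_ k)[]. Qed.
Let smI k : smooth (im k U). Proof. by case: tU => /(_ k)[]. Qed.

Lemma support_shell : exists M d : R, [/\ 0 < M, 0 < d &
  forall x, M < `|x| \/ `|x| < d -> U x = 0].
Proof.
case: tU => _ /compact_bounded[M0 [_ HM]] U0.
have sub x : U x != 0 -> tsupport U x by move=> ?; exact: subset_closure.
have : nbhs ((0, 0, 0) : R3 R) (~` tsupport U).
  by apply: open_nbhs_nbhs; split => //; exact/closed_openC/closed_closure.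
move=> /nbhs_ballP[d /= d0 Hd].
have M1 : M0 < `|M0| + 1 by rewrite (le_lt_trans (ler_norm _))// ltrDl.
exists (`|M0| + 1), d; split => //.
move=> x [xM|xd]; apply/eqP; apply: contraPT isT => /sub sx.
  by have : `|x| <= `|M0| + 1 := HM _ M1 x sx; rewrite leNgt xM.
have := Hd x; rewrite -ball_normE /= => /(_ _ sx).
by rewrite (_ : (0, 0, 0) - x = - x) ?normrN ?sub0r//; case=> //.
Qed.

Definition total1 x := field1 b (re up0 U) (im up0 U) (re up1 U) (im up1 U) x
  + field1 b (re dn0 U) (im dn0 U) (re dn1 U) (im dn1 U) x.
Definition total2 x := field2 b (re up0 U) (im up0 U) (re up1 U) (im up1 U) x
  + field2 b (re dn0 U) (im dn0 U) (re dn1 U) (im dn1 U) x.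
Definition total3 x := field3 b (re up0 U) (im up0 U) (re up1 U) (im up1 U) x
  + field3 b (re dn0 U) (im dn0 U) (re dn1 U) (im dn1 U) x.

Let U0re k x : U x = 0 -> re k U x = 0. Proof. by rewrite /re => ->; rewrite mxE. Qed.
Let U0im k x : U x = 0 -> im k U x = 0. Proof. by rewrite /im => ->; rewrite mxE. Qed.

Lemma shell_total1 M d : (forall x, M < `|x| \/ `|x| < d -> U x = 0) ->
  shellC1 M d total1.
Proof.
move=> U0 x x0; split; first by apply: C1D; exact: C1_field1.
move=> /U0 Ux; rewrite /total1.
by rewrite !field1_eq0 ?addr0//; by [exact: U0re|exact: U0im].
Qed.

Lemma shell_total2 M d : (forall x, M < `|x| \/ `|x| < d -> U x = 0) ->
  shellC1 M d total2.
Proof.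
move=> U0 x x0; split; first by apply: C1D; exact: C1_field2.
move=> /U0 Ux; rewrite /total2.
by rewrite !field2_eq0 ?addr0//; by [exact: U0re|exact: U0im].
Qed.

Lemma shell_total3 M d : (forall x, M < `|x| \/ `|x| < d -> U x = 0) ->
  shellC1 M d total3.
Proof.
move=> U0 x x0; split; first by apply: C1D; exact: C1_field3.
move=> /U0 Ux; rewrite /total3.
by rewrite !field3_eq0 ?addr0//; by [exact: U0re|exact: U0im].
Qed.

Definition div_total x := 'D_e1 total1 x + 'D_e2 total2 x + 'D_e3 total3 x.

Lemma integral_div_total : lebesgue3.-integrable (upcone m) (EFin \o div_total) /\
  (\int[lebesgue3]_(x in upcone m) (div_total x)%:E = 0)%E.
Proof.
have [M [d [M0 d0 U0]]] := support_shell.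
apply: (integral_divergence_upcone m0 M0 d0 (shell_total1 U0) (shell_total2 U0)
  (shell_total3 U0)) => x x2 x3.
apply: (bag_tangential c0 s0 (cos2Dsin2 omega) erefl _ _ _ _ _ _ _ _ _ x2 x3) => //.
exact: bag_condition_at.
Qed.

Lemma upcone_gt0 x : upcone m x -> 0 < x.2.
Proof. by apply: le_lt_trans; rewrite mulr_ge0 ?rho_ge0// ltW. Qed.

Lemma upcone_slope x : upcone m x -> C * erad x <= x.2.
Proof.
move=> xc; have x0 := upcone_gt0 xc.
have e0 := ltW (erad_gt0 x0).
rewrite -ler_sqr ?nnegrE ?mulr_ge0 ?(ltW c0) ?(ltW x0)//.
have h : C * rho x <= S * x.2.
  by move: (ltW xc); rewrite /m mulrAC ler_pdivrMr// [x.2 * _]mulrC.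
have : (C * rho x) ^+ 2 <= (S * x.2) ^+ 2.
  by rewrite ler_sqr ?nnegrE ?mulr_ge0 ?rho_ge0 ?(ltW c0) ?(ltW s0) ?(ltW x0).
have -> : (C * erad x) ^+ 2 = (C * rho x) ^+ 2 + (C * x.2) ^+ 2.
  rewrite !(@exprMn _ 2) -mulrDr sqr_erad /rho sqr_sqrtr//.
  by rewrite addr_ge0 ?sqr_ge0.
rewrite -(lerD2r ((C * x.2) ^+ 2)) => /le_trans -> //.
by rewrite !(@exprMn _ 2) -mulrDl [_ + C ^+ 2]addrC cos2Dsin2 mul1r.
Qed.

Let k := (pi / (4 * omega)) ^+ 2.

Lemma pointwise_bound x : upcone m x ->
  k * (cnorm (U x) ^+ 2 / enorm x ^+ 2) <= cnorm (dirac_op U x) ^+ 2 - div_total x.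
Proof.
move=> xc; have x0 := upcone_gt0 xc; have xs := upcone_slope xc.
have C01 : 0 <= C < 1 by rewrite (ltW c0).
have kC : k <= (1 + 2 * C) / (4 * (1 - C ^+ 2)).
  have -> : 1 - C ^+ 2 = S ^+ 2 by rewrite -(cos2Dsin2 omega) addrC addKr.
  exact: aperture_le.
have H1 := hardy_half (smR up0) (smI up0) (smR up1) (smI up1) x0 C01 erefl xs kC.
have H2 := hardy_half (smR dn0) (smI dn0) (smR dn1) (smI dn1) x0 C01 erefl xs kC.
rewrite cnorm_dens cnorm_dirac enormE.
have DE (f g : R3 R -> R) v : C1 f x -> C1 g x ->
    'D_v (fun y => f y + g y) x = 'D_v f x + 'D_v g x.
  by move=> Cf Cg; rewrite deriveD//; exact: C1_derivable.
have -> : div_total x =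
   ('D_e1 (field1 b (re up0 U) (im up0 U) (re up1 U) (im up1 U)) x
    + 'D_e2 (field2 b (re up0 U) (im up0 U) (re up1 U) (im up1 U)) x
    + 'D_e3 (field3 b (re up0 U) (im up0 U) (re up1 U) (im up1 U)) x)
 + ('D_e1 (field1 b (re dn0 U) (im dn0 U) (re dn1 U) (im dn1 U)) x
    + 'D_e2 (field2 b (re dn0 U) (im dn0 U) (re dn1 U) (im dn1 U)) x
    + 'D_e3 (field3 b (re dn0 U) (im dn0 U) (re dn1 U) (im dn1 U)) x).
  have D1 := DE _ _ e1 (C1_field1 b (smR up0) (smI up0) (smR up1) (smI up1) x0)
    (C1_field1 b (smR dn0) (smI dn0) (smR dn1) (smI dn1) x0).
  have D2 := DE _ _ e2 (C1_field2 b (smR up0) (smI up0) (smR up1) (smI up1) x0)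
    (C1_field2 b (smR dn0) (smI dn0) (smR dn1) (smI dn1) x0).
  have D3 := DE _ _ e3 (C1_field3 b (smR up0) (smI up0) (smR up1) (smI up1) x0)
    (C1_field3 b (smR dn0) (smI dn0) (smR dn1) (smI dn1) x0).
  apply: (eq_trans (congr2 (fun u v => u + v) (congr2 (fun u v => u + v) D1 D2) D3)).
  have perm (r1 r2 r3 r4 r5 r6 : R) :
      r1 + r2 + (r3 + r4) + (r5 + r6) = r1 + r3 + r5 + (r2 + r4 + r6) by ring.
  exact: perm.
have := lerD H1 H2; rewrite -exprVn -/b.
move: (_ + _ + 'D_e3 _ x) (_ + _ + 'D_e3 _ x) => V1 V2.
move: (weyl_sqr _ _ _ _ x) (weyl_sqr _ _ _ _ x) => W1 W2.
move: (dens _ _ _ _ _) (dens _ _ _ _ _) ((erad x)^-1 ^+ 2) => N1 N2 i H.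
rewrite (_ : k * _ = k * i * N2 + k * i * N1); last by ring.
by apply: (le_trans H); rewrite opprD addrACA.
Qed.

Lemma continuous_dirac x : {for x, continuous (fun y => cnorm (dirac_op U y) ^+ 2)}.
Proof.
have -> : (fun y => cnorm (dirac_op U y) ^+ 2) = (fun y =>
  weyl_sqr (re up0 U) (im up0 U) (re up1 U) (im up1 U) y
  + weyl_sqr (re dn0 U) (im dn0 U) (re dn1 U) (im dn1 U) y).
  by apply/funext => y; exact: cnorm_dirac.
have cD f v : smooth f -> {for x, continuous ('D_v f)}.
  by move=> /(smooth_C1 x)[].
have sq (f : R3 R -> R) : {for x, continuous f} -> {for x, continuous (fun y => f y ^+ 2)}.
  by move=> cf; exact: (cvgM cf cf).
have W p q s t : smooth p -> smooth q -> smooth s -> smooth t ->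
    {for x, continuous (weyl_sqr p q s t)}.
  move=> sp sq' ss st.
  exact: (cvgD (cvgD (cvgD
    (sq _ (cvgD (cvgD (cD _ e3 sp) (cD _ e1 ss)) (cD _ e2 st)))
    (sq _ (cvgB (cvgD (cD _ e3 sq') (cD _ e1 st)) (cD _ e2 ss))))
    (sq _ (cvgB (cvgB (cD _ e1 sp) (cD _ e2 sq')) (cD _ e3 ss))))
    (sq _ (cvgB (cvgD (cD _ e1 sq') (cD _ e2 sp)) (cD _ e3 st)))).
exact: (cvgD (W _ _ _ _ (smR up0) (smI up0) (smR up1) (smI up1))
  (W _ _ _ _ (smR dn0) (smI dn0) (smR dn1) (smI dn1))).
Qed.

Lemma continuous_weight x : upcone m x ->
  {for x, continuous (fun y => cnorm (U y) ^+ 2 / enorm y ^+ 2)}.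
Proof.
move=> /upcone_gt0 x0.
have -> : (fun y => cnorm (U y) ^+ 2 / enorm y ^+ 2) = (fun y =>
  (dens (re up0 U) (im up0 U) (re up1 U) (im up1 U) y
   + dens (re dn0 U) (im dn0 U) (re dn1 U) (im dn1 U) y)
  / (erad y * erad y)).
  by apply/funext => y; rewrite cnorm_dens enormE expr2.
have r0 : erad x * erad x != 0 by rewrite mulf_neq0// gt_eqF// erad_gt0.
apply: C1_continuous.
exact: (C1M (C1D (C1_dens (smR up0) (smI up0) (smR up1) (smI up1) x)
  (C1_dens (smR dn0) (smI dn0) (smR dn1) (smI dn1) x))
  (C1V r0 (C1M (C1_erad x0) (C1_erad x0)))).
Qed.

(** The divergence subtracted in [pointwise_bound] has integral zero. *)
Lemma hardy_dirac :
  (k%:E * \int[lebesgue3]_(x in cone omega) (cnorm (U x) ^+ 2 / enorm x ^+ 2)%:E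
   <= \int[lebesgue3]_(x in cone omega) (cnorm (dirac_op U x) ^+ 2)%:E)%E.
Proof.
have -> : cone omega = upcone m by [].
have mC : measurable (upcone m : set (mR * mR * mR)).
  by apply: open_measurable3; exact: open_upcone.
have mf (f : R3 R -> R) : (forall x, upcone m x -> {for x, continuous f}) ->
    measurable_fun (upcone m) (EFin \o f : mR * mR * mR -> \bar R).
  move=> cf; apply/measurable_EFinP; apply: measurable_fun_continuous3.
    exact: open_upcone.
  by move=> x /set_mem; exact: cf.
have mw := mf _ continuous_weight.
have md := mf _ (fun x _ => @continuous_dirac x).
have [Idiv Ediv] := integral_div_total.
have k0 : 0 <= k by rewrite sqr_ge0.
have w0 x : 0 <= cnorm (U x) ^+ 2 / enorm x ^+ 2 by rewrite divr_ge0 ?sqr_ge0.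
have d0 x : 0 <= cnorm (dirac_op U x) ^+ 2 by rewrite sqr_ge0.
rewrite -ge0_integralZl//; last by move=> x _; rewrite lee_fin.
set I := (X in (_ <= X)%E).
have [Ioo|] := ltP I +oo%E; last by rewrite leye_eq => /eqP ->; rewrite leey.
have Id : lebesgue3.-integrable (upcone m)
    (EFin \o (fun x => cnorm (dirac_op U x) ^+ 2)).
  apply/integrableP; split => //.
  rewrite (_ : (\int[_]_(x in _) `|_|)%E = I)//.
  by apply: eq_integral => x _; rewrite /= ger0_norm.
have -> : I = (\int[lebesgue3]_(x in upcone m)
    ((cnorm (dirac_op U x) ^+ 2)%:E - (div_total x)%:E))%E.
  by rewrite integralB// Ediv sube0.
have Idiff := integrableB mC Id Idiv.
apply: ge0_le_integral => //.
- by move=> x _; rewrite mule_ge0 ?lee_fin.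
- by apply: measurable_funeM.
- by case/integrableP: Idiff.
- by move=> x xc; rewrite -EFinM -EFinB lee_fin; exact: pointwise_bound.
Qed.

End Assembly.

Theorem proposition2p11 (R : realType) (omega : R) (u : R3 R -> C4 R)
    (homega : 0 < omega < pi / 2) (hu : dom_dirac omega u) :
  (((pi / (4 * omega)) ^+ 2)%:E *
     \int[lebesgue3]_(x in cone omega) (cnorm (u x) ^+ 2 / enorm x ^+ 2)%:E
   <= \int[lebesgue3]_(x in cone omega) (cnorm (dirac_op u x) ^+ 2)%:E)%E.
Proof.
case: hu => U [tU uU bagU].
have -> : (\int[lebesgue3]_(x in cone omega) (cnorm (u x) ^+ 2 / enorm x ^+ 2)%:E
  = \int[lebesgue3]_(x in cone omega) (cnorm (U x) ^+ 2 / enorm x ^+ 2)%:E)%E.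
  by apply: eq_integral => x xc; rewrite uU.
have -> : (\int[lebesgue3]_(x in cone omega) (cnorm (dirac_op u x) ^+ 2)%:E
  = \int[lebesgue3]_(x in cone omega) (cnorm (dirac_op U x) ^+ 2)%:E)%E.
  apply: eq_integral => x /set_mem xc; suff -> : dirac_op u x = dirac_op U x by [].
  have near_uU : \forall y \near x, u y = U y.
    have : \forall y \near x, cone omega y.
      by apply: open_nbhs_nbhs; split => //; exact: open_upcone.
    by apply: filterS => y yc; apply: uU; rewrite inE.
  rewrite /dirac_op; congr (_ *: _); apply: eq_bigr => j _; congr (_ *m _).
  apply/matrixP => k l; rewrite !mxE; congr (_ +i* _)%C; apply: near_eq_derive;
    by apply: filterS near_uU => y ->.
exact: hardy_dirac.
Qed.
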